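(* Consider the variational inequality VI$(S,F)$ and the iterates $v_k=(v_{k,1},\dots,v_{k,J})$, $x_k=(x_{k,1},\dots,x_{k,J})$ of the modified Popov method described in the context. Assume: (a) for every $j\in\{1,\dots,J\}$, $Y_j\subseteq\mathbb{R}^{n_j}$ is closed and convex, $S_j=X_j\cap Y_j$ is nonempty, and $g_{a}:\mathbb{R}^{n_j}\to\mathbb{R}$ is convex for every $a\in\mathscr{A}_j$; (b) there is $M_g>0$ with $\|d\|\le M_g$ for all $d\in\partial g_{a}(x_j)$, $x_j\in Y_j$, $a\in\mathscr{A}_j$, $j=1,\dots,J$; (c) $\|F(x)-F(y)\|\le L\|x-y\|$ for all $x,y\in Y$, with $L>0$; (d) $\langle F(x)-F(y),x-y\rangle\ge\mu\|x-y\|^2$ for all $x,y\in Y$, with $\mu>0$; (e) there is $c>0$ such that for all $j\in\{1,\dots,J\}$ (and every iteration $k\ge1$), $\mathrm{dist}^2(x_j,S_j)\le c\,\mathbb{E}\big[(g^+_{\omega_{k,j}^i}(x_j))^2\big]$ for all $x_j\in Y_j$ and $i=1,\dots,N_{k,j}$; (f) the step sizes satisfy $\alpha_k>0$, $\sum_{k=0}^\infty\alpha_k=\infty$, $\sum_{k=0}^\infty\alpha_k^2<\infty$, are non-increasing, i.e., $\alpha_{k+1}\le\alpha_k$, and, with constants $\tau>2$ and $\nu>1$, $$\alpha_k\le\min\left(\frac{\mu}{4\tau L^2},\ \frac{1-\frac2\tau}{\frac{2L}{\tau}+L\tau},\ \frac{1-\frac1\nu}{2\mu+L\tau}\right)\quad\text{for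 all }k\ge0;$$ (g) the scalar $\zeta_k$ of the analysis is $\zeta_k=\frac{q}{1-q}(1-\alpha_k\mu+2\tau L^2\alpha_k^2)$, where $q=\frac{\beta(2-\beta)}{cM_g^2}$. Let $x^*\in S$ be the (unique) solution of VI$(S,F)$. Then: (i) the iterates $x_k,v_k\in Y$ converge to $x^*$ almost surely and in expectation; (ii) the distance $\mathrm{dist}(x_k,S)$ converges to $0$ almost surely and in expectation.
   Context: Setting. $J\ge1$ agents; for each $j\in\{1,\dots,J\}$: a set $Y_j\subseteq\mathbb{R}^{n_j}$, a (possibly infinite) index set $\mathscr{A}_j$, functions $g_a:\mathbb{R}^{n_j}\to\mathbb{R}$ ($a\in\mathscr{A}_j$), $X_j=\bigcap_{a\in\mathscr{A}_j}\{x_j\in\mathbb{R}^{n_j}: g_a(x_j)\le0\}$, $S_j=X_j\cap Y_j$. Put $n=\sum_j n_j$, $Y=\prod_jY_j$, $S=\prod_jS_j$. The mapping $F:Y\to\mathbb{R}^n$ has blocks $[F(x)]_j\in\mathbb{R}^{n_j}$ (in the underlying game, $[F(x)]_j$ is the gradient of agent $j$'s cost in its own variable). VI$(S,F)$: find $x^*\in S$ with $\langle F(x^* ),x-x^*\rangle\ge0$ for all $x\in S$. Notation: $\|\cdot\|$ is the Euclidean norm, $g^+(x)=\max\{g(x),0\}$, $\partial$ is the convex subdifferential, $\Pi_C$ is Euclidean projection onto a closed convex set $C$, $\mathrm{dist}(x,C)=\min_{y\in C}\|x-y\|$. Random feasibility steps (agent $j$, iteration $k\ge1$). Input: $v_{k,j}\in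 Y_j$, deterministic batch size $N_{k,j}\ge1$ (integer), deterministic $\beta\in(0,2)$. Set $z_{k,j}^0=v_{k,j}$. For $i=1,\dots,N_{k,j}$: draw a random index $\omega_{k,j}^i\in\mathscr{A}_j$; if $g^+_{\omega_{k,j}^i}(z_{k,j}^{i-1})>0$ take $d_{k,j}^i\in\partial g^+_{\omega_{k,j}^i}(z_{k,j}^{i-1})$, otherwise take $d_{k,j}^i=d$ for some fixed $d\neq0$; set $$z_{k,j}^i=\Pi_{Y_j}\Big[z_{k,j}^{i-1}-\beta\,\tfrac{g^+_{\omega_{k,j}^i}(z_{k,j}^{i-1})}{\|d_{k,j}^i\|^2}d_{k,j}^i\Big].$$ Output: $x_{k,j}=z_{k,j}^{N_{k,j}}$. Regarding the sampling of the indices, assumption (e) is said to allow independent identically distributed sampling as well as sampling with distribution conditional on the past samples drawn at iteration $k$. Modified Popov method. Start from random $x_{0,j}\in Y_j$ with $\mathbb{E}\|x_{0,j}\|^2<\infty$. For $k\ge1$ and each $j$: $u_{k,j}=\Pi_{Y_j}[x_{k-1,j}-\alpha_{k-1}[F(u_{k-1})]_j]$; with $u_k=(u_{k,1},\dots,u_{k,J})$, $v_{k,j}=\Pi_{Y_j}[x_{k-1,j}-\alpha_{k-1}[F(u_k)]_j]$; then $x_{k,j}$ is the output of the random feasibility steps with input $v_{k,j}$, $N_{k,j}$. (The first iteration uses an initial auxiliary point $u_0$ at which $F$ is evaluated; its choice is not specified in the source.) The scalar $\zeta_k$ is only an artifact of the convergence analysis and is not a parameter of the method. The quantity $q$ lies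 in $(0,1]$ and is taken to be $<1$ without loss of generality. ''Converge in expectation'' means $\mathbb{E}\|v_k-x^*\|\to0$, $\mathbb{E}\|x_k-x^*\|\to0$, $\mathbb{E}[\mathrm{dist}(x_k,S)]\to0$. *)

(* Defs.v *)
From HB Require Import structures.
From mathcomp Require Export all_boot all_order all_algebra.
From mathcomp Require Export all_classical all_reals all_analysis.
Export Order.TTheory GRing.Theory Num.Theory.
Export numFieldNormedType.Exports.

Set Implicit Arguments.
Unset Strict Implicit.
Unset Printing Implicit Defensive.

Local Open Scope classical_set_scope.
Local Open Scope ring_scope.

Definition dot (R : realType) (m : nat) (x y : 'rV[R]_m) : R :=
  \sum_(i < m) x ord0 i * y ord0 i.

(* The norm that the library puts on ['rV[R]_m] is the maximum norm (it
   induces the same topology). *)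
Definition eucl (R : realType) (m : nat) (x : 'rV[R]_m) : R :=
  Num.sqrt (dot x x).

(* For C closed and nonempty the infimum is attained. *)
Definition dist (R : realType) (m : nat) (x : 'rV[R]_m) (C : set 'rV[R]_m) : R :=
  inf [set eucl (x - y) | y in C].

(* For C nonempty, closed and convex there is exactly one nearest point; the
   default value 0 is used only when there is none. *)
Definition proj (R : realType) (m : nat) (C : set 'rV[R]_m) (x : 'rV[R]_m)
    : 'rV[R]_m :=
  xget 0 [set p | C p /\ forall y, C y -> eucl (x - p) <= eucl (x - y)].

Definition subdifferential (R : realType) (m : nat) (f : 'rV[R]_m -> R)
    (x : 'rV[R]_m) : set 'rV[R]_m :=
  [set d | forall y, f x + dot d (y - x) <= f y].

Definition constraint_set (R : realType) (m : nat) (A : Type)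
    (g : A -> 'rV[R]_m -> R) : set 'rV[R]_m :=
  \bigcap_(a in [set: A]) [set x | g a x <= 0].

(* Vectors of R^n, n = sum_j n_j, have type ['rV[R]_(\sum_(j < J) n j)] and
   [submxrow x j] is the j-th block of x. *)
Definition product_set (R : realType) (J : nat) (n : 'I_J -> nat)
    (C : forall j : 'I_J, set 'rV[R]_(n j)) : set 'rV[R]_(\sum_(j < J) n j) :=
  [set x | forall j : 'I_J, C j (submxrow x j)].

Definition VI_solution (R : realType) (m : nat) (S : set 'rV[R]_m)
    (F : 'rV[R]_m -> 'rV[R]_m) (x : 'rV[R]_m) : Prop :=
  S x /\ forall y, S y -> 0 <= dot (F x) (y - x).

(* One run of the feasibility steps of one agent at one iteration, along the
   sample path of drawn indices [a i] and chosen directions [d i], 1 <= i <= N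
   ([f^\+] is the positive part of f). *)
Definition feasibility_steps (R : realType) (m : nat) (A : Type)
    (Y : set 'rV[R]_m) (g : A -> 'rV[R]_m -> R) (beta : R) (d0 : 'rV[R]_m)
    (N : nat) (a : nat -> A) (d z : nat -> 'rV[R]_m)
    (input output : 'rV[R]_m) : Prop :=
  [/\ z 0%N = input,
      forall i : nat, (1 <= i <= N)%N ->
        (if 0 < (g (a i))^\+ (z i.-1)
         then subdifferential ((g (a i))^\+) (z i.-1) (d i)
         else d i = d0) /\
        z i = proj Y (z i.-1 -
                (beta * ((g (a i))^\+ (z i.-1) / eucl (d i) ^+ 2)) *: d i)
    & output = z N].

Definition popov_step (R : realType) (J : nat) (n : 'I_J -> nat)
    (Y : forall j : 'I_J, set 'rV[R]_(n j))
    (F : 'rV[R]_(\sum_(j < J) n j) -> 'rV[R]_(\sum_(j < J) n j)) (alpha : R)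
    (x_prev u_prev u v : 'rV[R]_(\sum_(j < J) n j)) : Prop :=
  forall j : 'I_J,
    submxrow u j =
      proj (Y j) (submxrow x_prev j - alpha *: submxrow (F u_prev) j) /\
    submxrow v j =
      proj (Y j) (submxrow x_prev j - alpha *: submxrow (F u) j).

Definition random_vector (R : realType) (dO : measure_display)
    (Omega : measurableType dO) (m : nat) (X : Omega -> 'rV[R]_m) : Prop :=
  forall i : 'I_m, measurable_fun [set: Omega] (fun w => X w ord0 i).

Definition vector_events (R : realType) (T : Type) (m : nat)
    (X : T -> 'rV[R]_m) : set (set T) :=
  \bigcup_(i in [set: 'I_m])
    preimage_set_system [set: T] (fun w => X w ord0 i) measurable.

(* Generators of the sigma-algebra of the history before iteration k: the
   initial points, and the indices drawn and directions chosen by all agents at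
   iterations 1, ..., k - 1.  The directions are listed because a subgradient
   need not be a function of the current point and the drawn index. *)
Definition history (R : realType) (Omega : Type) (J : nat) (n : 'I_J -> nat)
    (dA : 'I_J -> measure_display) (A : forall j : 'I_J, measurableType (dA j))
    (N : nat -> 'I_J -> nat)
    (x0 u0 : Omega -> 'rV[R]_(\sum_(j < J) n j))
    (omega : nat -> forall j : 'I_J, nat -> Omega -> A j)
    (d : nat -> forall j : 'I_J, nat -> Omega -> 'rV[R]_(n j))
    (k : nat) : set (set Omega) :=
  vector_events x0 `|` vector_events u0 `|`
  \bigcup_(l in [set l : nat | (1 <= l < k)%N])
    \bigcup_(j in [set: 'I_J])
      \bigcup_(i in [set i : nat | (1 <= i <= N l j)%N])
        (preimage_set_system [set: Omega] (omega l j i) measurable `|`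
         vector_events (d l j i)).

(* h is a version of the conditional expectation of f given the sigma-algebra
   generated by G. *)
Definition is_cond_expectation (R : realType) (dO : measure_display)
    (Omega : measurableType dO) (P : probability Omega R)
    (G : set (set Omega)) (f h : Omega -> R) : Prop :=
  [/\ measurable_fun [set: g_sigma_algebraType G] h,
      P.-integrable [set: Omega] (EFin \o h)
    & forall B : set Omega, <<s G >> B ->
        (\int[P]_(w in B) (h w)%:E = \int[P]_(w in B) (f w)%:E)%E].

(* r is almost surely a lower bound of c * E[f | G].  When f is independent of
   G this says r <= c * E[f], and by the tower property it is implied by the
   same bound for any sigma-algebra that contains G. *)
Definition cond_expectation_ge (R : realType) (dO : measure_display)
    (Omega : measurableType dO) (P : probability Omega R)
    (G : set (set Omega)) (c : R) (f : Omega -> R) (r : R) : Prop :=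
  exists2 h : Omega -> R, is_cond_expectation P G f h
    & {ae P, forall w, r <= c * h w}.

(* Main.v *)
Require Import Defs.
From mathcomp Require Import ring lra measurable_realfun.

(** Write a_k, b_k for the squared distances of x_k, u_k to the solution x*, and
    D_k for the sum over the agents of the squared distances of the blocks of
    v_(k+1) to the feasible sets S_j.  One Popov step lets the Lyapunov function
    W_k = a_k + alpha_k mu b_k grow by at most K alpha_k^2 + eta D_k, where eta
    is as small as wanted, and decreases it by a multiple of alpha_k b_(k+1) and
    by the squared distance from x_k to u_(k+1) (popov_inequality,
    popov_step_descent).  The term eta D_k appears because x* solves the
    variational inequality over S only, whereas u and v merely lie in Y.

    The feasibility steps pay for it.  None of them moves away from x*, and the
    first one gains gamma times the squared violation of the sampled constraint
    at v_(k+1) (feasibility_steps_decrease).  As v_(k+1) is a function of the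
    history before the draw, the regularity assumption bounds the expected
    violation below by E D_k / c (cond_expectation_ge_random_point).  That
    assumption holds at each deterministic point outside a null set that depends
    on the point; the passage to the random point v_(k+1) discretizes it, and
    rests on the violations being Lipschitz on Y, hence on the existence of
    subgradients (subgradient_exists, pos_part_lipschitz).

    With eta c <= gamma / 2, the sequence E W_k is therefore quasi-Fejer, the
    sum of the E D_k is finite, and since the alpha_k have an infinite sum E W_k
    tends to 0 (lyapunov_cvg0).  Consequently the sum of the D_k is finite
    almost surely, so that almost every sample path satisfies the same
    deterministic recursion, now with the summable error K alpha_k^2 + eta D_k,
    and W_k tends to 0 along it by the same lemma.  Both kinds of convergence
    pass to v_(k+1), whose squared distance to x* is bounded by W_k plus the
    error, and to dist(x_k, S), which is at most the distance from x_k to x*. *)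

Set Implicit Arguments.
Unset Strict Implicit.
Unset Printing Implicit Defensive.

Local Open Scope classical_set_scope.
Local Open Scope ring_scope.

(** * Euclidean geometry of row vectors *)

Section Euclid.
Context {R : realType} {m : nat}.
Implicit Types (x y z : 'rV[R]_m) (s t : R).

Lemma dotC x y : dot x y = dot y x.
Proof. by apply: eq_bigr => i _; rewrite mulrC. Qed.

Lemma dotDl x y z : dot (x + y) z = dot x z + dot y z.
Proof. by rewrite /dot -big_split; apply: eq_bigr => i _; rewrite mxE mulrDl. Qed.

Lemma dotZl s x y : dot (s *: x) y = s * dot x y.
Proof. by rewrite /dot mulr_sumr; apply: eq_bigr => i _; rewrite mxE mulrA. Qed.

Lemma dotNl x y : dot (- x) y = - dot x y.
Proof. by rewrite -scaleN1r dotZl mulN1r. Qed.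

Lemma dotDr x y z : dot z (x + y) = dot z x + dot z y.
Proof. by rewrite dotC dotDl !(dotC z). Qed.

Lemma dotZr s x y : dot x (s *: y) = s * dot x y.
Proof. by rewrite dotC dotZl dotC. Qed.

Lemma dotNr x y : dot x (- y) = - dot x y.
Proof. by rewrite dotC dotNl dotC. Qed.

Definition dotE := (dotDl, dotDr, dotNl, dotNr, dotZl, dotZr).

Lemma dot_ge0 x : 0 <= dot x x.
Proof. by apply: sumr_ge0 => i _; rewrite -expr2 sqr_ge0. Qed.

Lemma dot_sub_scale x y t :
  dot (x - t *: y) (x - t *: y) = dot x x - 2 * t * dot x y + t ^+ 2 * dot y y.
Proof. by rewrite !dotE (dotC y x); ring. Qed.

Lemma eucl_ge0 x : 0 <= eucl x.
Proof. exact: sqrtr_ge0. Qed.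

Lemma eucl_sqr x : eucl x ^+ 2 = dot x x.
Proof. by rewrite sqr_sqrtr ?dot_ge0. Qed.

Lemma euclN x : eucl (- x) = eucl x.
Proof. by rewrite /eucl dotNl dotNr opprK. Qed.

Lemma euclC x y : eucl (x - y) = eucl (y - x).
Proof. by rewrite -euclN opprB. Qed.

Lemma normr_coord_le_eucl x (i : 'I_m) : `|x ord0 i| <= eucl x.
Proof.
rewrite -sqrtr_sqr ler_sqrt ?dot_ge0// /dot (bigD1 i)//= -expr2 lerDl.
by apply: sumr_ge0 => j _; rewrite -expr2 sqr_ge0.
Qed.

Lemma dot_eq0 x : dot x x = 0 -> x = 0.
Proof.
move=> x0; apply/rowP => i; rewrite mxE; apply/normr0_eq0/eqP.
by rewrite eq_le normr_ge0 andbT -(sqrtr0 R) -x0 normr_coord_le_eucl.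
Qed.

Lemma cauchy_schwarz x y : `|dot x y| <= eucl x * eucl y.
Proof.
rewrite -sqrtrM ?dot_ge0// -sqrtr_sqr ler_sqrt; last first.
  by rewrite mulr_ge0 ?dot_ge0.
have [/dot_eq0 ->|y0] := eqVneq (dot y y) 0.
  by rewrite -(scale0r (0 : 'rV[R]_m)) !dotZr !mul0r mulr0 expr0n.
have yp : 0 < dot y y by rewrite lt_def y0 dot_ge0.
have := dot_ge0 (dot y y *: x - dot x y *: y).
rewrite !dotE (dotC y x) => h.
rewrite -(ler_pM2l yp); nra.
Qed.

Lemma dot_le_eucl x y : dot x y <= eucl x * eucl y.
Proof. exact: le_trans (ler_norm _) (cauchy_schwarz x y). Qed.

Lemma eucl_triangle x y : eucl (x + y) <= eucl x + eucl y.
Proof.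
rewrite -(@ler_pXn2r _ 2) ?nnegrE ?addr_ge0 ?eucl_ge0// sqrrD !eucl_sqr !dotE.
have := dot_le_eucl x y; rewrite (dotC y x); lra.
Qed.

Lemma eucl_triangleB y x z : eucl (x - z) <= eucl (x - y) + eucl (y - z).
Proof. by rewrite (le_trans _ (eucl_triangle _ _))// subrKA. Qed.

Lemma eucl_le_sum_coord x : eucl x <= \sum_i `|x ord0 i|.
Proof.
have s0 : 0 <= \sum_i `|x ord0 i| by exact: sumr_ge0.
rewrite -(ger0_norm s0) -sqrtr_sqr ler_sqrt ?sqr_ge0// expr2 mulr_suml.
apply: ler_sum => i _; rewrite -expr2 -real_normK ?num_real// expr2.
by rewrite ler_wpM2l// (bigD1 i)//= lerDl sumr_ge0.
Qed.

(** The topology of row vectors is that of the maximum norm, and the Euclidean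
    norm is at most m times the maximum norm. *)
Lemma eucl_lipschitz_continuous (f : 'rV[R]_m -> R) :
  (forall x y, `|f x - f y| <= eucl (x - y)) -> continuous f.
Proof.
move=> fL x s /= /(nbhs_ballP (f x)) [e /= e0 es].
have m0 : 0 < m.+1%:R :> R by rewrite ltr0n.
apply/nbhs_ballP; exists (e / m.+1%:R) => /=; first by rewrite divr_gt0.
move=> y [_ xy]; apply: es; rewrite -ball_normE /ball_ /=.
rewrite (le_lt_trans (fL _ _))// (le_lt_trans (eucl_le_sum_coord _))//.
apply: (@le_lt_trans _ _ (\sum_(i < m) (e / m.+1%:R))).
  by apply: ler_sum => i _; rewrite !mxE; exact/ltW/xy.
rewrite sumr_const card_ord -[_ *+ _]mulr_natr mulrAC ltr_pdivrMr// ltr_pM2l//.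
by rewrite ltr_nat.
Qed.

Lemma eucl_sub_lipschitz x y z : `|eucl (x - y) - eucl (x - z)| <= eucl (y - z).
Proof.
rewrite ler_norml; apply/andP; split.
  by rewrite lerNl opprB lerBlDl; exact: eucl_triangleB.
by rewrite lerBlDl (euclC y z); exact: eucl_triangleB.
Qed.

End Euclid.

(** * Projection onto a closed convex set *)

Section Projection.
Context {R : realType} {m : nat} (Y : set 'rV[R]_m).
Hypothesis Ycl : closed Y.
Hypothesis Y0 : Y !=set0.

(** Outside a ball no point can compete with a fixed y0 in Y, and the rest of Y
    is compact. *)
Lemma nearest_point_exists (x : 'rV[R]_m) :
  exists p, Y p /\ forall y, Y y -> eucl (x - p) <= eucl (x - y).
Proof.
have [y0 Yy0] := Y0.
pose B : set 'rV[R]_m := [set y | eucl (x - y) <= eucl (x - y0)].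
have cont : continuous (fun y : 'rV[R]_m => eucl (x - y)).
  by apply: eucl_lipschitz_continuous => y z; exact: eucl_sub_lipschitz.
have clB : closed B.
  rewrite (_ : B = (fun y => eucl (x - y)) @^-1` [set z | z <= eucl (x - y0)])//.
  by apply: closed_comp; [move=> ? _; exact: cont|exact: closed_le].
have bndB : bounded_set (Y `&` B).
  exists (eucl (x - y0) + eucl x); split; first exact: num_real.
  move=> M ltM y [_ By] /=; rewrite [X in X <= _]/Num.norm/= mx_normrE.
  apply/bigmax_leP; split => [|[i j] _ /=].
    by rewrite (le_trans _ (ltW ltM))// addr_ge0// eucl_ge0.
  rewrite ord1; apply: (le_trans (normr_coord_le_eucl y j)).
  apply: le_trans (ltW ltM).
  rewrite -[y in eucl y](subrK x).
  by rewrite (le_trans (eucl_triangle _ _))// lerD2r (euclC y).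
have cpt : compact (Y `&` B).
  exact: bounded_closed_compact bndB (closedI Ycl clB).
have ne : (Y `&` B) !=set0 by exists y0; split => //; rewrite /B/=.
have [p /[!inE] -[Yp Bp] pmin] :=
  EVT_min_rV ne cpt (continuous_subspaceT cont).
exists p; split => // y Yy.
have [yB|/ltW yB] := leP (eucl (x - y)) (eucl (x - y0)).
  by apply: pmin; rewrite inE.
exact: le_trans Bp yB.
Qed.

Lemma projP (x : 'rV[R]_m) :
  Y (proj Y x) /\ forall y, Y y -> eucl (x - proj Y x) <= eucl (x - y).
Proof.
have [p Pp] := nearest_point_exists x.
exact: (@xgetI _ 0 [set p | Y p /\ forall y, Y y -> eucl (x - p) <= eucl (x - y)] p).
Qed.

Lemma proj_in x : Y (proj Y x).
Proof. by have [] := projP x. Qed.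

Hypothesis Ycvx : convex_set Y.

Lemma convex_setP x y t : Y x -> Y y -> 0 <= t <= 1 ->
  Y (t *: x + (1 - t) *: y).
Proof.
move=> Yx Yy t01.
have := Ycvx (Itv01 (proj1 (andP t01)) (proj2 (andP t01))) (mem_set Yx) (mem_set Yy).
by rewrite inE.
Qed.

(** Obtuse angle characterization: moving from the projection p towards y in Y
    cannot decrease the distance to x to first order. *)
Lemma proj_obtuse x y : Y y -> dot (x - proj Y x) (y - proj Y x) <= 0.
Proof.
move=> Yy; have [Yp pmin] := projP x; set p := proj Y x in Yp pmin *.
set b := dot _ _; rewrite leNgt; apply/negP => b0.
have c0 := dot_ge0 (y - p); set c := dot (y - p) (y - p) in c0.
pose t := Num.min 1 (b / (c + 1)).
have c1 : 0 < c + 1 by lra.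
(* so short a step that the second-order term t ^ 2 * c stays below t * b *)
have t0 : 0 < t by rewrite lt_min ltr01 divr_gt0.
have t1 : t <= 1 by rewrite ge_min lexx.
have tc : t * c <= b.
  have : t <= b / (c + 1) by rewrite ge_min lexx orbT.
  rewrite ler_pdivlMr// => tb; nra.
have Yt : Y (p + t *: (y - p)).
  have := convex_setP Yy Yp (_ : 0 <= t <= 1); rewrite t1 (ltW t0) => /(_ isT).
  by rewrite scalerBl scale1r addrCA scalerBr.
have := pmin _ Yt; rewrite -(@ler_pXn2r _ 2) ?nnegrE ?eucl_ge0// !eucl_sqr.
by rewrite opprD addrA dot_sub_scale -/b -/c; nra.
Qed.

Lemma proj_nonexpansive x y : eucl (proj Y x - proj Y y) <= eucl (x - y).
Proof.
have h1 := proj_obtuse x (proj_in y); have h2 := proj_obtuse y (proj_in x).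
set p := proj Y x in h1 h2 *; set r := proj Y y in h1 h2 *.
have h : dot (p - r) (p - r) <= dot (x - y) (p - r).
  by move: h1 h2; rewrite !dotE (dotC r p); lra.
have [->|pr] := eqVneq (eucl (p - r)) 0; first exact: eucl_ge0.
have pr0 : 0 < eucl (p - r) by rewrite lt_def pr eucl_ge0.
rewrite -(ler_pM2r pr0) -expr2 eucl_sqr.
exact: le_trans h (dot_le_eucl _ _).
Qed.

Lemma proj_id y : Y y -> proj Y y = y.
Proof.
move=> Yy; have [_ /(_ _ Yy)] := projP y.
rewrite subrr -(@ler_pXn2r _ 2) ?nnegrE ?eucl_ge0// !eucl_sqr => h.
apply/esym/subr0_eq/dot_eq0/eqP; rewrite eq_le dot_ge0 andbT (le_trans h)//.
by rewrite -(scale0r (0 : 'rV[R]_m)) dotZl mul0r.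
Qed.

Lemma proj_closer x y : Y y -> eucl (proj Y x - y) <= eucl (x - y).
Proof. by move=> Yy; rewrite -{1}(proj_id Yy) proj_nonexpansive. Qed.

End Projection.

(** * Subgradients of convex functions and the feasibility step *)

Section ConvexFunctions.
Context {R : realType} {m : nat}.
Implicit Types (f : 'rV[R]_m -> R) (x y h d : 'rV[R]_m).

Lemma convex_functionP f x y (t : R) :
  convex_function [set: convex_lmodType 'rV[R]_m] f -> 0 <= t <= 1 ->
  f (t *: x + (1 - t) *: y) <= t * f x + (1 - t) * f y.
Proof.
move=> fc t01.
exact: (fc (Itv01 (proj1 (andP t01)) (proj2 (andP t01))) x y (in_setT _) (in_setT _)).
Qed.

(** Hahn-Banach, one coordinate at a time: the slopes that the convex function
    forces on the new coordinate from the left lie below those that it forces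
    from the right, so their supremum extends the functional d by one
    coordinate. *)
Lemma subgradient_extension f x (k : 'I_m) d :
  convex_function [set: convex_lmodType 'rV[R]_m] f ->
  (forall h, (forall i : 'I_m, (k <= i)%N -> h ord0 i = 0) ->
     f x + dot d h <= f (x + h)) ->
  exists d', forall h, (forall i : 'I_m, (k < i)%N -> h ord0 i = 0) ->
     f x + dot d' h <= f (x + h).
Proof.
move=> fc dk; pose e : 'rV[R]_m := delta_mx ord0 k.
have conv (s t : R) h1 h2 : 0 < s -> 0 < t ->
    (forall i : 'I_m, (k <= i)%N -> h1 ord0 i = 0) ->
    (forall i : 'I_m, (k <= i)%N -> h2 ord0 i = 0) ->
    t * (f x + dot d h1) + s * (f x + dot d h2) <=
    s * f (x + (h2 + t *: e)) + t * f (x + (h1 - s *: e)).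
  move=> s0 t0 h10 h20; have st0 : 0 < s + t by lra.
  pose l := s / (s + t); have l01 : 0 <= l <= 1.
    apply/andP; split; first by rewrite divr_ge0// ltW.
    by rewrite ler_pdivrMr// mul1r lerDl ltW.
  have ls : l * (s + t) = s by rewrite divfK// gt_eqF.
  have lt : (1 - l) * (s + t) = t by rewrite mulrBl ls; lra.
  have := convex_functionP (x + (h2 + t *: e)) (x + (h1 - s *: e)) fc l01.
  have -> : l *: (x + (h2 + t *: e)) + (1 - l) *: (x + (h1 - s *: e)) =
            x + (l *: h2 + (1 - l) *: h1).
    have c : l * t = (1 - l) * s.
      by rewrite -{1}lt -{2}ls; ring.
    apply/rowP => i; rewrite !mxE.
    transitivity (x ord0 i + (l * h2 ord0 i + (1 - l) * h1 ord0 i) +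
      (l * t - (1 - l) * s) * (e ord0 i)); first by rewrite !mxE; ring.
    by rewrite c subrr mul0r addr0.
  have hz (i : 'I_m) : (k <= i)%N -> (l *: h2 + (1 - l) *: h1) ord0 i = 0.
    by move=> ki; rewrite !mxE h10// h20// !mulr0 addr0.
  have := dk _ hz.
  rewrite dotDr !dotZr => a b.
  have {a b} := le_trans a b; rewrite -(ler_pM2r st0) [X in _ <= X]mulrDl.
  rewrite -(mulrAC l) -(mulrAC (1 - l)) ls lt => ab.
  suff <- : (f x + (l * dot d h2 + (1 - l) * dot d h1)) * (s + t) =
    t * (f x + dot d h1) + s * (f x + dot d h2) by [].
  rewrite -{2}ls -{2}lt; ring.
pose Lo : set R := [set r | exists s h, [/\ 0 < s,
   forall i : 'I_m, (k <= i)%N -> h ord0 i = 0 &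
   r = (f x + dot d h - f (x + (h - s *: e))) / s]].
have z0 (i : 'I_m) : (k <= i)%N -> (0 : 'rV[R]_m) ord0 i = 0 by rewrite mxE.
have Lo_le t h : 0 < t -> (forall i : 'I_m, (k <= i)%N -> h ord0 i = 0) ->
    ubound Lo ((f (x + (h + t *: e)) - (f x + dot d h)) / t).
  move=> t0 h0 r [s [h1 [s0 h10 ->]]].
  rewrite ler_pdivrMr// mulrAC ler_pdivlMr//.
  have := conv s t h1 h s0 t0 h10 h0; lra.
have Lo0 : Lo !=set0.
  by exists ((f x + dot d 0 - f (x + (0 - 1 *: e))) / 1), 1, 0.
have Loub : has_ubound Lo by eexists; exact: (Lo_le 1 0 ltr01 z0).
pose c := sup Lo; pose d' := d + (c - d ord0 k) *: e.
exists d' => h h0; pose t := h ord0 k; pose h' := h - t *: e.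
have h'0 (i : 'I_m) : (k <= i)%N -> h' ord0 i = 0.
  rewrite leq_eqVlt => /orP[/eqP/val_inj <-|ki].
    by rewrite !mxE !eqxx mulr1 subrr.
  by rewrite !mxE h0// eqxx (_ : i == k = false) ?mulr0 ?subr0// -val_eqE gtn_eqF.
have dote (z : 'rV[R]_m) : dot e z = z ord0 k.
  rewrite /dot (bigD1 k)//= !mxE !eqxx mul1r big1 ?addr0// => i ik.
  by rewrite !mxE eqxx (negbTE ik) mul0r.
have hE : h = h' + t *: e by rewrite subrK.
have -> : dot d' h = dot d h' + t * c.
  by rewrite /d' /h' !dotE dote -/t (dotC d e) dote; ring.
rewrite {1}hE; have [t0|t0|<-] := ltgtP 0 t; last 1 first.
- by rewrite mul0r scale0r !addr0; exact: dk.
- have := ge_sup Lo0 (Lo_le t h' t0 h'0).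
  by rewrite -/c ler_pdivlMr//; lra.
- have : (f x + dot d h' - f (x + (h' - (- t) *: e))) / (- t) <= c.
    by apply: ub_le_sup => //; exists (- t), h'; split => //; rewrite oppr_gt0.
  rewrite ler_pdivrMr ?oppr_gt0// scaleNr opprK; lra.
Qed.

Lemma subgradient_exists f x :
  convex_function [set: convex_lmodType 'rV[R]_m] f ->
  exists d, subdifferential f x d.
Proof.
move=> fc.
have : forall k, (k <= m)%N -> exists d, forall h,
    (forall i : 'I_m, (k <= i)%N -> h ord0 i = 0) -> f x + dot d h <= f (x + h).
  elim=> [_|k IH km].
    exists 0 => h h0; rewrite (_ : h = 0); last by apply/rowP => i; rewrite h0 ?mxE.
    by rewrite -(scale0r (0 : 'rV[R]_m)) dotZl mul0r scale0r !addr0.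
  by have [d dk] := IH (ltnW km); exact: (@subgradient_extension f x (Ordinal km) d).
move=> /(_ _ (leqnn m))[d dP]; exists d => y; have := dP (y - x).
by rewrite [x + _]addrC subrK; apply => i; rewrite leqNgt ltn_ord.
Qed.

Variable (Y : set 'rV[R]_m) (g : 'rV[R]_m -> R) (M : R).
Hypothesis gc : convex_function [set: convex_lmodType 'rV[R]_m] g.
Hypothesis subgrad_le : forall y e, Y y -> subdifferential g y e -> eucl e <= M.

Lemma bounded_subgradients_lipschitz y z : Y y -> g y - g z <= M * eucl (y - z).
Proof.
move=> Yy; have [e eg] := subgradient_exists y gc.
have := eg z; rewrite -opprB dotNr => h.
have := dot_le_eucl e (y - z).
have := ler_wpM2r (eucl_ge0 (y - z)) (subgrad_le Yy eg); lra.
Qed.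

Lemma funrposE f y : f^\+ y = Num.max (f y) 0.
Proof. by []. Qed.

Lemma pos_part_gt0 f y : 0 < f^\+ y -> f^\+ y = f y.
Proof. by rewrite funrposE maxEle; case: ifP => //; rewrite ltxx. Qed.

Lemma pos_part_lipschitz y z : Y y -> Y z ->
  `|g^\+ y - g^\+ z| <= M * eucl (y - z).
Proof.
move=> Yy Yz; rewrite !funrposE.
have := bounded_subgradients_lipschitz z Yy.
have := bounded_subgradients_lipschitz y Yz; rewrite (euclC z y).
rewrite ler_norml !maxEle; case: ifP; case: ifP => a b c; lra.
Qed.

(** Near a point where g is positive, g and its positive part agree, and a
    subgradient inequality of a convex function is a local property. *)
Lemma subdifferential_pos_part y d :
  0 < g^\+ y -> subdifferential (g^\+) y d -> subdifferential g y d.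
Proof.
move=> gy0 dg z.
have gy : g^\+ y = g y by exact: pos_part_gt0.
have {}gy0 : 0 < g y by rewrite -gy.
(* z' is the mirror image of z; convexity between z' and z at y bounds g from
   below near y *)
pose z' := y - (z - y).
pose B := Num.max 0 (g z').
have B0 : 0 <= B by rewrite le_max lexx.
have Bz' : g z' <= B by rewrite le_max lexx orbT.
(* t is so small that g is still positive at w = y + t (z - y) *)
pose t := g y / (g y + B + 1).
have D0 : 0 < g y + B + 1 by lra.
have t0 : 0 < t by rewrite divr_gt0.
have tE : t * (g y + B + 1) = g y by rewrite divfK// gt_eqF.
have t1 : t <= 1 by nra.
pose w := y + t *: (z - y).
have wE : w = t *: z + (1 - t) *: y.
  by apply/rowP => i; rewrite !mxE; ring.
have w_le : g w <= t * g z + (1 - t) * g y.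
  by rewrite wE; apply: convex_functionP => //; rewrite t1 ltW.
have t1' : 0 < 1 + t by lra.
pose l := 1 / (1 + t).
have l01 : 0 <= l <= 1.
  by apply/andP; split; [rewrite divr_ge0// ltW|rewrite ler_pdivrMr// mul1r lerDl ltW].
have lE : l * (1 + t) = 1 by rewrite divfK// gt_eqF.
have gyl : g y <= l * g w + (1 - l) * g z'.
  have {1}-> : y = l *: w + (1 - l) *: z'.
    apply/rowP => i; rewrite !mxE.
    transitivity (y ord0 i + (l * (1 + t) - 1) * (z ord0 i - y ord0 i)).
      by rewrite lE; ring.
    by ring.
  exact: convex_functionP.
have gw : 0 < g w.
  have h2 : (1 + t) * g y <= g w + t * g z'.
    have : (1 + t) * g y <= (1 + t) * (l * g w + (1 - l) * g z') by rewrite ler_pM2l.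
    have -> : (1 + t) * (l * g w + (1 - l) * g z') =
       (l * (1 + t)) * g w + ((1 + t) - l * (1 + t)) * g z' by ring.
    by rewrite lE; lra.
  nra.
have := dg w; rewrite gy (_ : g^\+ w = g w); last first.
  by rewrite funrposE maxEle leNgt gw.
rewrite /w addrAC subrr add0r dotZr -/w => h.
have {w_le}h := le_trans h w_le.
rewrite -(ler_pM2l t0); lra.
Qed.

(** One feasibility step is a Polyak subgradient step for g on Y: by the
    subgradient inequality, every zero of the positive part of g in Y gets
    closer by a multiple of the squared violation. *)
Lemma feasibility_step_decrease (beta : R) (d0 d z z' y : 'rV[R]_m) :
  closed Y -> convex_set Y -> 0 < M -> 0 < beta < 2 ->
  Y z -> Y y -> g y <= 0 ->
  (if 0 < g^\+ z then subdifferential (g^\+) z d else d = d0) ->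
  z' = proj Y (z - (beta * (g^\+ z / eucl d ^+ 2)) *: d) ->
  eucl (z' - y) ^+ 2 <=
    eucl (z - y) ^+ 2 - beta * (2 - beta) / M ^+ 2 * (g^\+ z) ^+ 2.
Proof.
move=> Ycl Ycvx M0 /andP[b0 b2] Yz Yy gy0 dP ->.
have Y0 : Y !=set0 by exists y.
have closer w : eucl (proj Y w - y) ^+ 2 <= eucl (w - y) ^+ 2.
  by rewrite lerXn2r ?nnegrE ?eucl_ge0//; exact: proj_closer.
case: ltP dP => [gz0 dg|gz0 _]; last first.
  have -> : g^\+ z = 0.
    by apply/eqP; rewrite eq_le gz0 funrposE le_max lexx orbT.
  by rewrite mul0r mulr0 scale0r subr0 expr0n/= mulr0 subr0; exact: closer.
apply: le_trans (closer _) _.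
have dg' := subdifferential_pos_part gz0 dg.
have gz : g^\+ z = g z by exact: pos_part_gt0.
have dM := subgrad_le Yz dg'.
have := dg' y; rewrite -gz -opprB dotNr.
set p := g^\+ z in gz0 *; set D := eucl d ^+ 2; set s := beta * (p / D) => hd.
have {}hd : p <= dot d (z - y) by lra.
have D0 : 0 < D.
  rewrite lt_def sqr_ge0 andbT; apply/negP => /eqP D0.
  have := dot_le_eucl d (z - y).
  have -> : eucl d = 0 by apply/eqP; rewrite -sqrf_eq0; apply/eqP.
  by rewrite mul0r; lra.
have DM : D <= M ^+ 2 by rewrite lerXn2r ?nnegrE ?eucl_ge0// ltW.
have M20 : 0 < M ^+ 2 by rewrite exprn_gt0.
rewrite addrAC !eucl_sqr dot_sub_scale -(eucl_sqr d) -/D dotC.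
have sD : s * D = beta * p by rewrite /s -mulrA divfK// gt_eqF.
have s0 : 0 < s by rewrite mulr_gt0// divr_gt0.
have e1 : beta * (2 - beta) / M ^+ 2 * p ^+ 2 <= s * ((2 - beta) * p).
  have -> : s * ((2 - beta) * p) = beta * (2 - beta) / D * p ^+ 2.
    by rewrite /s; ring.
  rewrite ler_pM2r ?exprn_gt0// ler_pM2l; last by rewrite mulr_gt0//; lra.
  by rewrite lef_pV2 ?posrE.
have e2 : s * p <= s * dot d (z - y) by rewrite ler_pM2l.
have e3 : s ^+ 2 * D = s * (beta * p) by rewrite -sD; ring.
rewrite e3; lra.
Qed.

End ConvexFunctions.

(** * Block vectors, distance to a set and Popov's inequality *)

Section Blocks.
Context {R : realType} {J : nat} {n : 'I_J -> nat}.
Implicit Types x y : 'rV[R]_(\sum_(j < J) n j).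

Lemma dot_blocks x y :
  dot x y = \sum_(j < J) dot (submxrow x j) (submxrow y j).
Proof.
have dot_mulmx k (a b : 'rV[R]_k) : dot a b = (a *m b^T) ord0 ord0.
  by rewrite !mxE; apply: eq_bigr => i _; rewrite !mxE.
rewrite dot_mulmx -{1}(submxrowK x) -{1}(submxrowK y) tr_mxrow mul_mxrow_mxcol.
by rewrite summxE; apply: eq_bigr => j _; rewrite dot_mulmx.
Qed.

Lemma eucl_sqr_blocks x :
  eucl x ^+ 2 = \sum_(j < J) eucl (submxrow x j) ^+ 2.
Proof. by rewrite eucl_sqr dot_blocks; apply: eq_bigr => j _; rewrite eucl_sqr. Qed.

Lemma submxrowZ (a : R) x j : submxrow (a *: x) j = a *: submxrow x j.
Proof. by apply/rowP => i; rewrite !mxE. Qed.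

(** Projecting block by block is projecting on the product, so it inherits the
    obtuse angle inequality. *)
Lemma block_proj_obtuse (Y : forall j : 'I_J, set 'rV[R]_(n j)) p v y :
  (forall j, closed (Y j)) -> (forall j, convex_set (Y j)) ->
  (forall j, submxrow v j = proj (Y j) (submxrow p j)) ->
  product_set Y y -> dot (p - v) (y - v) <= 0.
Proof.
move=> Ycl Ycvx vE Yy; rewrite dot_blocks; apply: sumr_le0 => j _.
rewrite !submxrowB vE; have Yyj := Yy j.
by apply: proj_obtuse => //; exists (submxrow y j).
Qed.

End Blocks.

Section Distance.
Context {R : realType} {m : nat} (C : set 'rV[R]_m).
Hypothesis C0 : C !=set0.

Let has_inf_dist (x : 'rV[R]_m) : has_inf [set eucl (x - y) | y in C].
Proof.
have [y Cy] := C0; split; first by exists (eucl (x - y)), y.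
by exists 0 => _ [z _ <-]; exact: eucl_ge0.
Qed.

Lemma dist_ge0 x : 0 <= dist x C.
Proof.
by apply: lb_le_inf => [|_ [z _ <-]]; [have [] := has_inf_dist x|exact: eucl_ge0].
Qed.

Lemma dist_le x y : C y -> dist x C <= eucl (x - y).
Proof. by move=> Cy; apply: ge_inf; [have [] := has_inf_dist x|exists y]. Qed.

Lemma dist_approx x e : 0 < e -> exists2 y, C y & eucl (x - y) < dist x C + e.
Proof.
by move=> e0; have [_ [y Cy <-] h] := inf_adherent e0 (has_inf_dist x); exists y.
Qed.

Lemma dist_lipschitz x y : `|dist x C - dist y C| <= eucl (x - y).
Proof.
have le a b : dist a C <= dist b C + eucl (a - b).
  apply/ler_addgt0Pr => e e0; have [z Cz h] := dist_approx b e0.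
  have := dist_le a Cz; have := eucl_triangleB b a z; lra.
by rewrite ler_norml; have := le x y; have := le y x; rewrite (euclC y); lra.
Qed.

End Distance.

(** The two projections of Popov's method are added up: testing the one that
    defines v at the solution xs, and the one that defines u at v, leaves the
    cross term of F u - F u', which Lipschitz continuity absorbs for small
    steps, and strong monotonicity gains the term in u - xs.  As u need not be
    feasible, the variational inequality only enters through the defect r. *)
Lemma popov_inequality {R : realType} {m : nat}
    (x u' u v xs Fu' Fu Fs : 'rV[R]_m) (a L mu r : R) :
  0 < a -> 0 < mu -> a * L ^+ 2 <= mu / 8 ->
  dot (x - a *: Fu - v) (xs - v) <= 0 ->
  dot (x - a *: Fu' - u) (v - u) <= 0 ->
  eucl (Fu - Fu') ^+ 2 <= L ^+ 2 * eucl (u - u') ^+ 2 ->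
  mu * eucl (u - xs) ^+ 2 <= dot (Fu - Fs) (u - xs) ->
  dot Fs (xs - v) <= r ->
  eucl (v - xs) ^+ 2 + eucl (x - u) ^+ 2 + 3 / 2 * (a * mu * eucl (u - xs) ^+ 2)
  <= eucl (x - xs) ^+ 2 + a * mu * eucl (u' - xs) ^+ 2
     + 8 * a ^+ 2 * eucl Fs ^+ 2 + 2 * a * r.
Proof.
move=> a0 mu0 aL hv hu hL hmu hr; rewrite !eucl_sqr in hL hmu *.
have young (s : R) (p w : 'rV[R]_m) : 0 < s ->
    2 * dot p w <= s * dot w w + s^-1 * dot p p.
  move=> s0; have := dot_ge0 (s *: w - p); rewrite !dotE (dotC w p) => h.
  have si : 0 < s^-1 by rewrite invr_gt0.
  have ss : s^-1 * s = 1 by rewrite mulVf// gt_eqF.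
  have : 0 <= s^-1 * (s * (s * dot w w - dot p w) - (s * dot p w - dot p p)).
    by apply: mulr_ge0; [exact: ltW|lra].
  rewrite [X in 0 <= X](_ : _ = (s^-1 * s) * (s * dot w w)
    - (s^-1 * s) * (2 * dot p w) + s^-1 * dot p p); last by ring.
  by rewrite ss; lra.
(* the weights 3/4 and 1/8 leave a nonnegative multiple of the square of u - v *)
have y1 := young (3 / 4) (a *: (Fu - Fu')) (u - v) ltac:(lra).
have y2 := young (1 / 8) (a *: Fs) (v - u) ltac:(lra).
have y3 : dot (u - u') (u - u') <=
    2 * dot (u - xs) (u - xs) + 2 * dot (u' - xs) (u' - xs).
  have := dot_ge0 ((u - xs) + (u' - xs)).
  rewrite !dotE (dotC u' u) (dotC xs u) (dotC xs u'); lra.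
have uv0 := dot_ge0 (u - v).
have e : dot (v - xs) (v - xs) + dot (x - u) (x - u) + dot (u - v) (u - v)
    = dot (x - xs) (x - xs) + 2 * dot (x - a *: Fu - v) (xs - v)
      + 2 * dot (x - a *: Fu' - u) (v - u)
      + 2 * dot (a *: (Fu - Fu')) (u - v) + 2 * dot (a *: Fs) (v - u)
      - 2 * a * dot (Fu - Fs) (u - xs) + 2 * a * dot Fs (xs - v).
  rewrite !dotE ?(dotC u x) ?(dotC v x) ?(dotC xs x) ?(dotC v u) ?(dotC xs u).
  by rewrite ?(dotC xs v); ring.
have a1 : a * (mu * dot (u - xs) (u - xs)) <= a * dot (Fu - Fs) (u - xs).
  by rewrite ler_pM2l.
have a2 : a * dot Fs (xs - v) <= a * r by rewrite ler_pM2l.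
have yL : a ^+ 2 * dot (Fu - Fu') (Fu - Fu') <=
    a * mu / 4 * (dot (u - xs) (u - xs) + dot (u' - xs) (u' - xs)).
  apply: (@le_trans _ _ (a * (a * L ^+ 2) * dot (u - u') (u - u'))).
    have -> : a * (a * L ^+ 2) * dot (u - u') (u - u') =
       a ^+ 2 * (L ^+ 2 * dot (u - u') (u - u')) by ring.
    by rewrite ler_wpM2l ?sqr_ge0.
  apply: (@le_trans _ _ (a * (mu / 8) * dot (u - u') (u - u'))).
    by rewrite ler_wpM2r ?dot_ge0// ler_wpM2l ?(ltW a0).
  have -> : a * mu / 4 * (dot (u - xs) (u - xs) + dot (u' - xs) (u' - xs)) =
    a * (mu / 8) * (2 * dot (u - xs) (u - xs) + 2 * dot (u' - xs) (u' - xs)) by field.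
  by rewrite ler_wpM2l//; apply: mulr_ge0; [exact: ltW|lra].
move: y1 y2; rewrite !dotZl !dotZr.
have -> : dot (v - u) (v - u) = dot (u - v) (u - v).
  by rewrite -(opprB u v) dotNl dotNr opprK.
have v3 : (3 / 4 : R)^-1 = 4 / 3 by field.
have v8 : (1 / 8 : R)^-1 = 8 by field.
rewrite v3 v8 => y1 y2.
have m1 : 0 <= a * mu * dot (u - xs) (u - xs).
  by rewrite !mulr_ge0 ?dot_ge0 ?(ltW a0) ?(ltW mu0).
have m2 : 0 <= a * mu * dot (u' - xs) (u' - xs).
  by rewrite !mulr_ge0 ?dot_ge0 ?(ltW a0) ?(ltW mu0).
move: e; rewrite !dotZl => e.
lra.
Qed.

(** * Measurability of functions of random vectors *)

Section Discretization.
Context {R : realType} {m : nat} {d : measure_display} {T : measurableType d}.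
Variables (Y : set 'rV[R]_m) (V : T -> 'rV[R]_m).
Hypothesis mV : forall i : 'I_m, measurable_fun [set: T] (fun w => V w ord0 i).
Hypothesis VY : forall w, Y (V w).
Hypothesis Y0 : Y !=set0.

(** The cells of a cubic grid that meet Y are countably many; rep picks a point
    of Y in each of them, so that the discretized vector still lies in Y. *)
Lemma random_vector_discretization (e : R) : 0 < e ->
  exists (idx : T -> nat) (rep : nat -> 'rV[R]_m),
    [/\ forall k, measurable (idx @^-1` [set k]),
        forall k, Y (rep k)
      & forall w, eucl (V w - rep (idx w)) <= e].
Proof.
move=> e0; have [y0 Yy0] := Y0.
pose dl := e / m.+1%:R.
have m0 : 0 < m.+1%:R :> R by rewrite ltr0n.
have dl0 : 0 < dl by rewrite divr_gt0.
have dle : dl * m%:R <= e.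
  by rewrite /dl mulrAC ler_pdivrMr// ler_pM2l// ler_nat.
move: dl dl0 dle => dl dl0 dle.
pose cell (y : 'rV[R]_m) : 'rV[int]_m := \row_i Num.floor (y ord0 i / dl).
pose rep k := xget y0 [set y | Y y /\ pickle (cell y) = k].
exists (fun w => pickle (cell (V w))), rep; split => [k|k|w].
- have [[c ck]|nc] := pselect (exists c : 'rV[int]_m, pickle c = k); last first.
    rewrite (_ : _ @^-1` _ = set0)//; apply/seteqP; split => // w /= wk.
    by apply: nc; exists (cell (V w)).
  rewrite (_ : _ @^-1` _ = \bigcap_(i in [set: 'I_m])
     [set w | V w ord0 i \in `[(c ord0 i)%:~R * dl, (c ord0 i + 1)%:~R * dl[ ]).
    apply: fin_bigcap_measurable => // i _.
    have := mV i measurableT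
      (measurable_itv `[(c ord0 i)%:~R * dl, (c ord0 i + 1)%:~R * dl[).
    by rewrite setTI.
  apply/seteqP; split => w /=.
    rewrite -ck => /(pcan_inj pickleK) wc i _ /=; rewrite in_itv/=.
    have := floor_itv (V w ord0 i / dl).
    by rewrite ler_pdivlMr// ltr_pdivrMr// -wc !mxE.
  move=> h; rewrite -ck; congr pickle; apply/rowP => i; rewrite mxE.
  apply/floor_def; rewrite ler_pdivlMr// ltr_pdivrMr//.
  by have := h i I; rewrite /= in_itv.
- rewrite /rep; case: xgetP => [y -> [] //|_]; exact: Yy0.
- have [_ repw] : Y (rep (pickle (cell (V w)))) /\
      pickle (cell (rep (pickle (cell (V w))))) = pickle (cell (V w)).
    apply: (@xgetI _ y0 [set y | Y y /\ pickle (cell y) = pickle (cell (V w))] (V w)).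
    by split.
  rewrite (le_trans (eucl_le_sum_coord _))//.
  apply: (@le_trans _ _ (\sum_(i < m) dl)); last first.
    by rewrite sumr_const card_ord -[_ *+ _]mulr_natr.
  apply: ler_sum => i _.
  move: repw => /(pcan_inj pickleK)/rowP/(_ i); rewrite !mxE => repw.
  have h1 := floor_itv (V w ord0 i / dl).
  have h2 := floor_itv (rep (pickle (cell (V w))) ord0 i / dl).
  move: h2; rewrite repw; move: h1.
  rewrite !ler_pdivlMr// !ltr_pdivrMr// !intrD !mulrDl mul1r.
  rewrite ler_norml; lra.
Qed.

(** A Caratheodory function composed with a random vector is a limit of its
    values along the discretizations. *)
Lemma measurable_comp_random_vector (h : T -> 'rV[R]_m -> R) :
  (forall y, Y y -> measurable_fun [set: T] (h ^~ y)) ->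
  (forall w, exists K, forall y z, Y y -> Y z ->
    `|h w y - h w z| <= K * eucl (y - z)) ->
  measurable_fun [set: T] (fun w => h w (V w)).
Proof.
move=> mh hL.
have /choice[dsc dscP] : forall l : nat, exists p : (T -> nat) * (nat -> 'rV[R]_m),
    [/\ forall k, measurable (p.1 @^-1` [set k]), forall k, Y (p.2 k)
      & forall w, eucl (V w - p.2 (p.1 w)) <= l.+1%:R^-1].
  move=> l; have [|idx [rep P]] := @random_vector_discretization l.+1%:R^-1.
    by rewrite invr_gt0 ltr0n.
  by exists (idx, rep).
apply: (@measurable_fun_cvg _ _ _ setT (fun l w => h w ((dsc l).2 ((dsc l).1 w)))).
  move=> l _ B mB; have [midx repY _] := dscP l; rewrite setTI.
  rewrite (_ : _ @^-1` _ = \bigcup_k ((dsc l).1 @^-1` [set k] `&`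
      (h ^~ ((dsc l).2 k)) @^-1` B)).
    apply: bigcupT_measurable => k; apply: measurableI => //.
    by have := mh _ (repY k) measurableT _ mB; rewrite setTI.
  apply/seteqP; split => [w Bw|w [k _ [/= <- ]]//].
  by exists ((dsc l).1 w).
move=> w _; have [K KP] := hL w; apply/cvgrPdist_le => e e0.
have K0 : 0 <= `|K| by [].
near=> l; have [_ repY le] := dscP l.
rewrite (le_trans (KP _ _ _ _))//.
rewrite (le_trans (ler_wpM2r (eucl_ge0 _) (ler_norm K)))//.
rewrite (le_trans (ler_wpM2l K0 (le w)))//.
apply: (@le_trans _ _ ((`|K| + 1) * l.+1%:R^-1)).
  by rewrite ler_wpM2r ?lerDl// invr_ge0.
rewrite ler_pdivrMr ?ltr0n// mulrC -ler_pdivrMr//.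
near: l; exists (Num.truncn ((`|K| + 1) / e)) => // l /= Kl.
rewrite (le_trans (ltW (truncnS_gt _)))// ler_nat ltnS//.
Unshelve. all: by end_near. Qed.

End Discretization.

Section VectorMeasurability.
Context {R : realType} {d : measure_display} {T : measurableType d}.

Lemma measurable_inv_ge0 (f : T -> R) : (forall w, 0 <= f w) ->
  measurable_fun [set: T] f -> measurable_fun [set: T] (fun w => (f w)^-1).
Proof.
move=> f0 mf; rewrite (_ : (fun w => _) = fun w => powR (f w) (-1)).
  exact: measurableT_comp (measurable_powR _) mf.
by apply/funext => w; rewrite powR_inv1.
Qed.

Lemma measurable_dot m (V W : T -> 'rV[R]_m) :
  random_vector V -> random_vector W ->
  measurable_fun [set: T] (fun w => dot (V w) (W w)).
Proof. by move=> mV mW; apply: measurable_sum => i; exact: measurable_funM. Qed.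

Lemma measurable_eucl_sqr m (V : T -> 'rV[R]_m) :
  random_vector V -> measurable_fun [set: T] (fun w => eucl (V w) ^+ 2).
Proof.
move=> mV; rewrite (_ : (fun w => _) = fun w => dot (V w) (V w)).
  exact: measurable_dot.
by apply/funext => w; rewrite eucl_sqr.
Qed.

Lemma random_vectorB m (V W : T -> 'rV[R]_m) :
  random_vector V -> random_vector W -> random_vector (fun w => V w - W w).
Proof.
move=> mV mW i; rewrite (_ : (fun w => _) = (fun w => V w ord0 i - W w ord0 i)).
  exact: measurable_funB.
by apply/funext => w; rewrite !mxE.
Qed.

Lemma random_vectorZ m (s : T -> R) (V : T -> 'rV[R]_m) :
  measurable_fun [set: T] s -> random_vector V ->
  random_vector (fun w => s w *: V w).
Proof.
move=> ms mV i; rewrite (_ : (fun w => _) = (fun w => s w * V w ord0 i)).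
  exact: measurable_funM.
by apply/funext => w; rewrite !mxE.
Qed.

Lemma random_vector_cst m (v : 'rV[R]_m) : random_vector (fun _ : T => v).
Proof. by move=> i; exact: measurable_cst. Qed.

Lemma random_vector_comp m p (Y : set 'rV[R]_m) (K : R) (f : 'rV[R]_m -> 'rV[R]_p)
    (V : T -> 'rV[R]_m) :
  Y !=set0 -> (forall w, Y (V w)) -> random_vector V ->
  (forall y z, Y y -> Y z -> eucl (f y - f z) <= K * eucl (y - z)) ->
  random_vector (f \o V).
Proof.
move=> Y0 VY mV fK i.
apply: (@measurable_comp_random_vector _ _ _ _ Y V mV VY Y0 (fun _ y => f y ord0 i)).
  by move=> y _; exact: measurable_cst.
move=> _; exists K => y z Yy Yz; apply: le_trans (fK _ _ Yy Yz).
by have := normr_coord_le_eucl (f y - f z) i; rewrite !mxE.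
Qed.

Lemma random_vector_proj m (Y : set 'rV[R]_m) (V : T -> 'rV[R]_m) :
  closed Y -> Y !=set0 -> convex_set Y -> random_vector V ->
  random_vector (fun w => proj Y (V w)).
Proof.
move=> Ycl Y0 Ycvx mV.
apply: (@random_vector_comp _ _ [set: _] 1) => //; first by exists 0.
by move=> y z _ _; rewrite mul1r; exact: proj_nonexpansive.
Qed.

Lemma random_vector_blocks J (n : 'I_J -> nat)
    (V : T -> 'rV[R]_(\sum_(j < J) n j)) :
  random_vector V <-> forall j, random_vector (fun w => submxrow (V w) j).
Proof.
split => [mV j i|mV i].
  rewrite (_ : (fun w => _) = fun w => V w ord0 (tagnat.Rank j i)); first exact: mV.
  by apply/funext => w; rewrite !mxE.
have := mV (tagnat.sig1 i) (tagnat.sig2 i).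
rewrite (_ : (fun w => _) = fun w => V w ord0 i)//.
by apply/funext => w; rewrite mxE tagnat.sig2K.
Qed.

End VectorMeasurability.

(** * Conditional bounds at random points *)

Section ConditionalBound.
Context {R : realType} {dO : measure_display} {Omega : measurableType dO}.
Variables (P : probability Omega R) (G : set (set Omega)) (c : R).
Hypothesis Gm : G `<=` measurable.
Hypothesis c0 : 0 < c.

Lemma generated_sigma_algebra_measurable (B : set Omega) :
  <<s G >> B -> measurable B.
Proof. by move=> /(smallest_sub (@sigma_algebra_measurable _ Omega) Gm). Qed.

Lemma cond_expectation_ge_integral (f : Omega -> R) (r : R) (B : set Omega) :
  0 <= r -> cond_expectation_ge P G c f r -> <<s G >> B ->
  (\int[P]_(w in B) r%:E <= c%:E * \int[P]_(w in B) (f w)%:E)%E.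
Proof.
move=> r0 [h [mh ih hE] rh] GB.
have mB := generated_sigma_algebra_measurable GB.
have ihB : P.-integrable B (EFin \o h).
  exact: integrableS ih.
have mhB : measurable_fun B (fun w => (c * h w)%:E).
  apply/measurable_EFinP; apply: measurable_funM => //.
  by apply/measurable_EFinP; exact: measurable_int ihB.
have mhB' : measurable_fun B (fun w => (Num.max (c * h w) 0)%:E).
  apply/measurable_EFinP; apply: measurable_maxr => //.
  exact/measurable_EFinP.
rewrite -hE//.
have -> : (c%:E * \int[P]_(w in B) (h w)%:E = \int[P]_(w in B) (c * h w)%:E)%E.
  by rewrite -integralZl//.
(* h may be negative on a null set; its positive part is compared first *)
apply: (@le_trans _ _ (\int[P]_(w in B) (Num.max (c * h w) 0)%:E)%E).
  apply: ae_ge0_le_integral => //.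
  - by move=> w _; rewrite lee_fin le_max lexx orbT.
  - by apply: filterS rh => w rw _; rewrite lee_fin le_max rw.
rewrite (@ae_eq_integral _ _ _ _ _ (fun w => (c * h w)%:E))//.
by apply: filterS rh => w rw _; rewrite /= max_l// (le_trans r0).
Qed.

(** Young's inequality for b = a + (b - a), scaled so that both the factor and
    the error become trivial as e tends to 0. *)
Lemma sqr_perturbation (a b s e : R) : 0 < e -> `|b - a| <= s * e ->
  b ^+ 2 <= (1 + e) * a ^+ 2 + s ^+ 2 * (e + e ^+ 2).
Proof.
move=> e0 ba; have : `|b - a| ^+ 2 <= (s * e) ^+ 2.
  by rewrite lerXn2r ?nnegrE// (le_trans _ ba).
rewrite real_normK ?num_real// => h.
have : 0 <= (e * a - (b - a)) ^+ 2 by exact: sqr_ge0.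
rewrite sqrrB => k.
have k' : 2 * (a * (b - a)) <= e * a ^+ 2 + e^-1 * (b - a) ^+ 2.
  rewrite -(ler_pM2l e0) [X in _ <= X]mulrDr (mulrA e e^-1) mulfV ?gt_eqF// mul1r.
  move: k; rewrite -mulr_natl; nra.
have h' : e^-1 * (b - a) ^+ 2 <= s ^+ 2 * e.
  rewrite mulrC ler_pdivrMr//; move: h; rewrite exprMn; nra.
have -> : b ^+ 2 = a ^+ 2 + 2 * (a * (b - a)) + (b - a) ^+ 2 by ring.
move: h; rewrite exprMn; nra.
Qed.

(** The conditional bound is given at each deterministic point outside a null
    set that depends on the point.  On a countable discretization of V those
    null sets are harmless: the bound at rep k is integrated over the event
    where V is in the k-th cell, which is an event of G.  Refining the cells
    gives the bound at V itself. *)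
Lemma cond_expectation_ge_random_point {m : nat} (Y : set 'rV[R]_m)
    (V : Omega -> 'rV[R]_m) (psi : Omega -> 'rV[R]_m -> R)
    (rho : 'rV[R]_m -> R) (M : R) :
  Y !=set0 -> (forall w, Y (V w)) ->
  @random_vector R _ (g_sigma_algebraType G) m V ->
  (forall y, Y y -> measurable_fun [set: Omega] (psi ^~ y)) ->
  (forall w y z, Y y -> Y z -> `|psi w y - psi w z| <= M * eucl (y - z)) ->
  (forall y z, `|rho y - rho z| <= eucl (y - z)) ->
  (forall y, Y y ->
     cond_expectation_ge P G c (fun w => psi w y ^+ 2) (rho y ^+ 2)) ->
  (\int[P]_w (rho (V w) ^+ 2)%:E <= c%:E * \int[P]_w (psi w (V w) ^+ 2)%:E)%E.
Proof.
move=> Y0 VY mV mpsi psiL rhoL cge.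
have mVO : random_vector V.
  move=> i _ B mB; apply: generated_sigma_algebra_measurable.
  exact: (mV i measurableT B mB).
have mpsiV : measurable_fun [set: Omega] (fun w => psi w (V w)).
  by apply: (measurable_comp_random_vector mVO VY) => // w; exists M; exact: psiL.
have mrhoV : measurable_fun [set: Omega] (fun w => rho (V w)).
  apply: (@measurable_comp_random_vector _ _ _ _ _ _ mVO VY Y0 (fun _ y => rho y)) => //.
  by move=> w; exists 1 => y z _ _; rewrite mul1r.
pose I := (\int[P]_w (psi w (V w) ^+ 2)%:E)%E.
have I0 : (0 <= I)%E by apply: integral_ge0 => w _; rewrite lee_fin sqr_ge0.
have Pcst (s : R) : (\int[P]_w s%:E = s%:E)%E.
  rewrite integral_cst// -[RHS]mule1; congr (_ * _)%E; exact: probability_setT.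
have key (e : R) : 0 < e ->
    (\int[P]_w (rho (V w) ^+ 2)%:E <=
      (1 + e)%:E * (c%:E * ((1 + e)%:E * I + (M ^+ 2 * (e + e ^+ 2))%:E))
      + (e + e ^+ 2)%:E)%E.
  move=> e0; have e1 : 0 <= 1 + e by lra.
  have ee : 0 <= e + e ^+ 2 by rewrite addr_ge0 ?sqr_ge0// ltW.
  have [idx [rep [midx repY repV]]] :=
    @random_vector_discretization R m _ (g_sigma_algebraType G) Y V mV VY Y0 e e0.
  have midxO k : measurable (idx @^-1` [set k] : set Omega).
    exact: generated_sigma_algebra_measurable (midx k).
  pose V' (w : Omega) := rep (idx w).
  have mcomp (f : Omega -> 'rV[R]_m -> R) :
      (forall y, Y y -> measurable_fun [set: Omega] (f ^~ y)) ->
      measurable_fun [set: Omega] (fun w => f w (V' w)).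
    move=> mf _ B mB; rewrite setTI.
    rewrite (_ : _ @^-1` _ = \bigcup_k (idx @^-1` [set k] `&` (f ^~ (rep k)) @^-1` B)).
      apply: bigcupT_measurable => k; apply: measurableI => //.
      by have := mf _ (repY k) measurableT _ mB; rewrite setTI.
    apply/seteqP; split => [w Bw|w [k _ [/= <- ]]//].
    by exists (idx w).
  have part (f : Omega -> R) : measurable_fun [set: Omega] f -> (forall w, 0 <= f w) ->
     (\int[P]_w (f w)%:E = \sum_(k <oo) \int[P]_(w in idx @^-1` [set k]) (f w)%:E)%E.
    move=> mf f0.
    have UT : \bigcup_k (idx @^-1` [set k]) = [set: Omega].
      by apply/seteqP; split => // w _; exists (idx w).
    rewrite -{1}UT ge0_integral_bigcup//.
    - by rewrite UT; exact/measurable_EFinP.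
    - by move=> w _; rewrite lee_fin.
    - apply/trivIsetP => i j _ _ /eqP ij; apply/seteqP; split => // w [/= wi wj].
      by apply: ij; rewrite -wi.
  have mrho' : measurable_fun [set: Omega] (fun w => rho (V' w)).
    by apply: (mcomp (fun _ y => rho y)) => y _; exact: measurable_cst.
  have mpsi' := mcomp _ mpsi.
  have step1 : (\int[P]_w (rho (V' w) ^+ 2)%:E <=
                c%:E * \int[P]_w (psi w (V' w) ^+ 2)%:E)%E.
    rewrite part//; [|exact: measurable_funX|by move=> w; exact: sqr_ge0].
    rewrite part//; [|exact: measurable_funX|by move=> w; exact: sqr_ge0].
    rewrite -nneseriesZl; last first.
      by move=> k _; apply: integral_ge0 => w _; rewrite lee_fin sqr_ge0.
    apply: lee_nneseries => [k _ _|k _].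
      by apply: integral_ge0 => w _; rewrite lee_fin sqr_ge0.
    have := cond_expectation_ge_integral (sqr_ge0 (rho (rep k))) (cge _ (repY k)) (midx k).
    rewrite (eq_integral (fun w : Omega => (rho (V' w) ^+ 2)%:E)); last first.
      by move=> w /[!inE] /= wk; rewrite /V' wk.
    rewrite [X in (_ <= _ * X)%E -> _](eq_integral (fun w : Omega => (psi w (V' w) ^+ 2)%:E))//.
    by move=> w /[!inE] /= wk; rewrite /V' wk.
  have step2 : (\int[P]_w (rho (V w) ^+ 2)%:E <=
      (1 + e)%:E * \int[P]_w (rho (V' w) ^+ 2)%:E + (e + e ^+ 2)%:E)%E.
    rewrite -ge0_integralZl//; last 2 first.
    - exact/measurable_EFinP/measurable_funX.
    - by move=> w _; rewrite lee_fin sqr_ge0.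
    rewrite -(Pcst (e + e ^+ 2)) -ge0_integralD//; last 2 first.
    - by move=> w _; rewrite -EFinM lee_fin mulr_ge0// sqr_ge0.
    - apply/measurable_EFinP/measurable_funM => //; exact: measurable_funX.
    apply: ge0_le_integral => //.
    - by move=> w _; rewrite lee_fin sqr_ge0.
    - exact/measurable_EFinP/measurable_funX.
    - apply/measurable_EFinP/measurable_funD => //; apply: measurable_funM => //.
      exact: measurable_funX.
    move=> w _; rewrite -EFinM -EFinD lee_fin.
    have := @sqr_perturbation (rho (V' w)) (rho (V w)) 1 e e0.
    rewrite expr1n !mul1r; apply; exact: le_trans (rhoL _ _) (repV w).
  have step3 : (\int[P]_w (psi w (V' w) ^+ 2)%:E <=
      (1 + e)%:E * I + (M ^+ 2 * (e + e ^+ 2))%:E)%E.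
    have M0 : 0 <= M ^+ 2 * (e + e ^+ 2) by rewrite mulr_ge0 ?sqr_ge0.
    rewrite -ge0_integralZl//; last 2 first.
    - exact/measurable_EFinP/measurable_funX.
    - by move=> w _; rewrite lee_fin sqr_ge0.
    rewrite -(Pcst (M ^+ 2 * (e + e ^+ 2))) -ge0_integralD//; last 2 first.
    - by move=> w _; rewrite -EFinM lee_fin mulr_ge0// sqr_ge0.
    - apply/measurable_EFinP/measurable_funM => //; exact: measurable_funX.
    apply: ge0_le_integral => //.
    - by move=> w _; rewrite lee_fin sqr_ge0.
    - exact/measurable_EFinP/measurable_funX.
    - apply/measurable_EFinP/measurable_funD => //; apply: measurable_funM => //.
      exact: measurable_funX.
    move=> w _; rewrite -EFinM -EFinD lee_fin.
    have := @sqr_perturbation (psi w (V w)) (psi w (V' w)) `|M| e e0.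
    rewrite real_normK ?num_real//; apply.
    rewrite (le_trans (psiL _ _ _ (repY _) (VY w)))// euclC.
    rewrite (le_trans (ler_wpM2r (eucl_ge0 _) (ler_norm M)))//.
    by rewrite ler_wpM2l.
  apply: (le_trans step2); rewrite leeD2r// lee_wpmul2l//.
  by rewrite (le_trans step1)// lee_wpmul2l// lee_fin ltW.
case: (ltgtP I +oo%E) => [Ioo||Ioo]; last 2 first.
- by rewrite ltNge leey.
- by rewrite -/I Ioo gt0_muley ?lte_fin// leey.
have Ifin : I \is a fin_num by rewrite ge0_fin_numE.
rewrite -/I -(fineK Ifin); set i := fine I.
have i0 : 0 <= i by rewrite -lee_fin fineK.
pose K := c * (3 * i + 4 * M ^+ 2) + 2.
have K0 : 0 < K.
  by have := sqr_ge0 M => M0; apply: ltr_wpDl => //; apply: mulr_ge0; [exact: ltW|lra].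
apply/lee_addgt0Pr => e e0.
pose t := Num.min 1 (e / K).
have t0 : 0 < t by rewrite lt_min ltr01 divr_gt0.
have t1 : t <= 1 by rewrite ge_min lexx.
have tK : t * K <= e by rewrite -ler_pdivlMr// ge_min lexx orbT.
apply: (le_trans (key t t0)).
rewrite -(fineK Ifin) -/i -EFinM -EFinD -!EFinM -!EFinD lee_fin.
have tt : t ^+ 2 <= t by rewrite expr2 ler_piMl// ltW.
have ttt : t ^+ 3 <= t by rewrite exprS ler_piMr ?(ltW t0)//; lra.
have M0 := sqr_ge0 M.
apply: (@le_trans _ _ (c * i + t * K)); last by rewrite lerD2l.
have -> : (1 + t) * (c * ((1 + t) * i + M ^+ 2 * (t + t ^+ 2))) + (t + t ^+ 2)
   = c * i + c * i * (2 * t + t ^+ 2) + c * M ^+ 2 * (t + 2 * t ^+ 2 + t ^+ 3)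
     + (t + t ^+ 2) by ring.
have h1 : c * i * (2 * t + t ^+ 2) <= c * i * (3 * t).
  by apply: ler_wpM2l; [rewrite mulr_ge0// ltW|lra].
have h2 : c * M ^+ 2 * (t + 2 * t ^+ 2 + t ^+ 3) <= c * M ^+ 2 * (4 * t).
  by apply: ler_wpM2l; [rewrite mulr_ge0// ltW|lra].
rewrite /K; lra.
Qed.

End ConditionalBound.

(** * Quasi-Fejer sequences *)

Section Sequences.
Context {R : realType}.
Implicit Types (W e r u : nat -> R).

Lemma summable_is_cvg_series u : (forall k, 0 <= u k) ->
  (\sum_(0 <= k <oo) (u k)%:E < +oo)%E <-> cvgn (series u).
Proof.
move=> u0.
have nd : nondecreasing_seq (series u) by apply: nondecreasing_series => k _ _.
split => [sfin|cu].
  apply: nondecreasing_is_cvgn => //.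
  have fin : (\sum_(0 <= k <oo) (u k)%:E)%E \is a fin_num.
    by rewrite ge0_fin_numE//; apply: nneseries_ge0 => k _ _; rewrite lee_fin.
  exists (fine (\sum_(0 <= k <oo) (u k)%:E)%E) => _ [k _ <-].
  rewrite -lee_fin fineK// -sumEFin.
  by apply: nneseries_lim_ge => i _ _; rewrite lee_fin.
apply: (@le_lt_trans _ _ (limn (series u))%:E); last exact: ltry.
apply: lime_le; first by apply: is_cvg_nneseries => k _ _; rewrite lee_fin.
by apply: nearW => k; rewrite sumEFin lee_fin; exact: nondecreasing_cvgn_le.
Qed.

(** W minus the partial sums of r is nonincreasing and bounded below; summing the
    recursion bounds the partial sums of e. *)
Lemma quasi_fejer W e r :
  (forall k, 0 <= W k) -> (forall k, 0 <= e k) -> (forall k, 0 <= r k) ->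
  (forall k, W k.+1 + e k <= W k + r k) -> cvgn (series r) ->
  cvgn W /\ cvgn (series e).
Proof.
move=> W0 e0 r0 We cr.
have ndr : nondecreasing_seq (series r) by apply: nondecreasing_series => k _ _.
have rle := nondecreasing_cvgn_le ndr cr.
have cV : cvgn (W \- series r).
  apply: nonincreasing_is_cvgn.
    apply/nonincreasing_seqP => k /=; rewrite seriesSr.
    by have := We k; have := e0 k; lra.
  exists (- limn (series r)) => _ [k _ <-] /=.
  by have := rle k; have := W0 k; lra.
split.
  have -> : W = (W \- series r) \+ series r by apply/funext => k /=; rewrite subrK.
  exact: is_cvgD.
apply: nondecreasing_is_cvgn; first by apply: nondecreasing_series => k _ _.
have bnd k : series e k + W k <= W 0%N + series r k.
  elim: k => [|k IH]; first by rewrite /series/= !big_geq// addr0 add0r.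
  by rewrite !seriesSr; have := We k; lra.
exists (W 0%N + limn (series r)) => _ [k _ <-].
by have := bnd k; have := rle k; have := W0 k; lra.
Qed.

(** The Lyapunov function converges by quasi-Fejer monotonicity.  Its limit is
    zero because the terms alpha k * b k.+1 are summable although the alpha k
    are not: b cannot stay away from zero, and a follows b. *)
Lemma lyapunov_cvg0 (alpha a b t r : nat -> R) (mu : R) :
  0 < mu -> (forall k, 0 < alpha k) -> (forall k, alpha k.+1 <= alpha k) ->
  ~ cvgn (series alpha) ->
  (forall k, 0 <= a k) -> (forall k, 0 <= b k) -> (forall k, 0 <= t k) ->
  (forall k, 0 <= r k) -> cvgn (series r) ->
  (forall k, a k <= 2 * b k.+1 + 2 * t k) ->
  (forall k, a k.+1 + t k + 3 / 2 * (alpha k * mu * b k.+1) <=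
             a k + alpha k * mu * b k + r k) ->
  (fun k => a k + alpha k * mu * b k) @ \oo --> 0.
Proof.
move=> mu0 al0 alN alD a0 b0 t0 r0 cr abt rec.
pose W k := a k + alpha k * mu * b k.
pose e k := t k + mu / 2 * (alpha k * b k.+1).
have mb0 k l : 0 <= alpha l * mu * b k.
  by rewrite mulr_ge0// mulr_ge0// ltW.
have ab0 k : 0 <= alpha k * b k.+1 by rewrite mulr_ge0// ltW.
have W0 k : 0 <= W k by rewrite addr_ge0.
have e0 k : 0 <= e k.
  by rewrite addr_ge0// mulr_ge0// ltW// divr_gt0.
have We k : W k.+1 + e k <= W k + r k.
  have : alpha k.+1 * (mu * b k.+1) <= alpha k * (mu * b k.+1).
    by rewrite ler_wpM2r// mulr_ge0// ltW.
  by have := rec k; rewrite /W /e; lra.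
have [cW ce] := quasi_fejer W0 e0 r0 We cr.
have ct : cvgn (series t).
  apply: series_le_cvg ce => // k; rewrite lerDl.
  by rewrite mulr_ge0// ltW// divr_gt0.
have cab : cvgn (series (fun k => alpha k * b k.+1)).
  have : cvgn (series (fun k => mu / 2 * (alpha k * b k.+1))).
    apply: series_le_cvg ce => // k; last by rewrite lerDr.
    by rewrite mulr_ge0// ltW// divr_gt0.
  move=> /(@is_cvg_seriesZ _ _ (mu / 2)^-1).
  rewrite (_ : _ *: _ = fun k => alpha k * b k.+1)//; apply/funext => k.
  change ((mu / 2)^-1 * (mu / 2 * (alpha k * b k.+1)) = alpha k * b k.+1).
  by rewrite mulKf// gt_eqF// divr_gt0.
have t_0 := cvg_series_cvg_0 ct.
have ab_0 := cvg_series_cvg_0 cab.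
suff W_0 : limn W = 0 by rewrite -[X in _ --> X]W_0.
apply: contrapT => /eqP Wn0.
have W_ge0 : 0 <= limn W by apply: limr_ge => //; exact: nearW.
have {Wn0 W_ge0}Wp : 0 < limn W by rewrite lt_def Wn0.
set w := limn W in Wp.
have Ww : W @ \oo --> w by [].
(* eventually W >= 3 w / 4 while alpha * mu * b and t are at most w / 8, so that
   a >= 5 w / 8 and, a following b, b >= 3 w / 16 *)
have : \forall k \near \oo, w / 8 <= b k.+2.
  have near1 : \forall k \near \oo, 3 / 4 * w <= W k.+1.
    have : (fun k => W k.+1) @ \oo --> w by rewrite (cvg_shiftS W).
    move=> /cvgrPdist_le/(_ (w / 4)) h; have : 0 < w / 4 by lra.
    move=> /h; apply: filterS => k; rewrite ler_norml; lra.
  have near2 : \forall k \near \oo, alpha k * b k.+1 <= w / (8 * mu).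
    have wm : 0 < w / (8 * mu) by rewrite divr_gt0// mulr_gt0.
    move/cvgrPdist_le : ab_0 => /(_ _ wm); apply: filterS => k.
    by rewrite sub0r normrN ger0_norm.
  have near3 : \forall k \near \oo, t k.+1 <= w / 8.
    have w8 : 0 < w / 8 by lra.
    have : (fun k => t k.+1) @ \oo --> (0 : R) by rewrite (cvg_shiftS t).
    move=> /cvgrPdist_le/(_ _ w8); apply: filterS => k.
    by rewrite sub0r normrN ger0_norm.
  near=> k.
  have h1 : 3 / 4 * w <= W k.+1 by near: k.
  have h2 : alpha k * b k.+1 <= w / (8 * mu) by near: k.
  have h3 : t k.+1 <= w / 8 by near: k.
  have h4 : alpha k.+1 * mu * b k.+1 <= w / 8.
    have : alpha k.+1 * (mu * b k.+1) <= alpha k * (mu * b k.+1).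
      by rewrite ler_wpM2r// mulr_ge0// ltW.
    have : mu * (alpha k * b k.+1) <= mu * (w / (8 * mu)) by rewrite ler_pM2l.
    have -> : mu * (w / (8 * mu)) = w / 8 by field; rewrite gt_eqF.
    by lra.
  by have := abt k.+1; move: h1 h3 h4; rewrite /W; lra.
move=> [K _ hK]; apply: alD.
have nda : nondecreasing_seq (series alpha).
  by apply: nondecreasing_series => k _ _; exact: ltW.
have nds : nondecreasing_seq (series (fun k => alpha k * b k.+1)).
  by apply: nondecreasing_series => k _ _.
apply: nondecreasing_is_cvgn => //.
have bnd k : series alpha k <=
    series alpha K.+1 + 8 / w * series (fun k => alpha k * b k.+1) k.
  elim: k => [|k IH].
    rewrite (le_trans (nda 0%N K.+1 (leq0n _)))// lerDl mulr_ge0 ?divr_ge0//.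
      exact: ltW.
    by apply: sumr_ge0.
  have [kK|Kk] := leqP k K.
    rewrite (le_trans (nda k.+1 K.+1 kK))// lerDl mulr_ge0 ?divr_ge0//.
      exact: ltW.
    by apply: sumr_ge0.
  rewrite (seriesSr alpha) (seriesSr _ k) mulrDr addrA lerD//.
  have : w / 8 <= b k.+1 by case: k Kk {IH} => // k Kk; exact: hK.
  move=> h /=; rewrite mulrCA ler_peMr ?(ltW (al0 _))//.
  have -> : 8 / w * b k.+1 = b k.+1 / (w / 8) by field; rewrite gt_eqF.
  by rewrite ler_pdivlMr ?mul1r//; lra.
exists (series alpha K.+1 + 8 / w * limn (series (fun k => alpha k * b k.+1))).
move=> _ [k _ <-]; rewrite (le_trans (bnd k))// lerD2l ler_pM2l ?divr_gt0//.
exact: nondecreasing_cvgn_le.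
Unshelve. all: by end_near. Qed.

End Sequences.

(** * The Lyapunov recursion in expectation and along sample paths *)

Section StochasticLyapunov.
Context {R : realType} {dO : measure_display} {Omega : measurableType dO}.
Variable (P : probability Omega R).
Implicit Types f g : Omega -> R.

Local Notation integ f := (P.-integrable [set: Omega] (EFin \o f)).

Lemma integrable_dominated f g : measurable_fun [set: Omega] f ->
  (forall w, 0 <= f w) -> (forall w, f w <= g w) -> integ g -> integ f.
Proof.
move=> mf f0 fg ig; apply: le_integrable ig => //; first exact/measurable_EFinP.
move=> w _ /=; rewrite lee_fin ger0_norm// ger0_norm//.
exact: le_trans (fg w).
Qed.

Lemma integrable_addr f g : integ f -> integ g -> integ (fun w => f w + g w).
Proof. by move=> fi gi; exact: (integrableD measurableT fi gi). Qed.

Lemma integrable_scaler (s : R) f : integ f -> integ (fun w => s * f w).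
Proof. by move=> fi; exact: (integrableZl measurableT s fi). Qed.

Lemma integrable_cstr (s : R) : integ (fun _ => s).
Proof. exact: finite_measure_integrable_cst. Qed.

Lemma Rintegral_probability_cst (s : R) : \int[P]_w s = s.
Proof.
rewrite Rintegral_cst// -[RHS]mulr1; congr (_ * _).
by rewrite -[RHS]/(fine 1%E); congr fine; exact: probability_setT.
Qed.

Lemma integrable_ge0_lty f : measurable_fun [set: Omega] f ->
  (forall w, 0 <= f w) -> (\int[P]_w (f w)%:E < +oo)%E -> integ f.
Proof.
move=> mf f0 fi; apply/integrableP; split; first exact/measurable_EFinP.
by under eq_integral do rewrite /= ger0_norm//.
Qed.

Lemma EFin_Rintegral f : integ f -> (\int[P]_w f w)%:E = (\int[P]_w (f w)%:E)%E.
Proof. by move=> fi; rewrite fineK//; exact: integrable_fin_num. Qed.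

(** By Beppo Levi the sum of the series has a finite expectation, so it is finite
    at almost every point. *)
Lemma ae_summable (D : nat -> Omega -> R) :
  (forall k, measurable_fun [set: Omega] (D k)) -> (forall k w, 0 <= D k w) ->
  (forall k, integ (D k)) ->
  cvgn (series (fun k => \int[P]_w D k w)) ->
  {ae P, forall w, cvgn (series (fun k => D k w))}.
Proof.
move=> mD D0 iD cD.
have mDE k : measurable_fun [set: Omega] (fun w => (D k w)%:E).
  exact/measurable_EFinP.
have D0E k w : [set: Omega] w -> (0 <= (D k w)%:E)%E by rewrite lee_fin.
have E0 k : 0 <= \int[P]_w D k w by apply: Rintegral_ge0.
have : P.-integrable [set: Omega] (fun w => \sum_(k <oo) (D k w)%:E)%E.
  apply/integrableP; split.
    by apply: ge0_emeasurable_sum => // k w _ _; rewrite lee_fin.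
  under eq_integral => w _.
    rewrite gee0_abs; last by apply: nneseries_ge0 => k _ _; rewrite lee_fin.
    over.
  rewrite integral_nneseries//.
  move/(summable_is_cvg_series E0) : cD.
  by under eq_eseriesr do rewrite EFin_Rintegral//.
move=> /(integrable_ae measurableT); apply: filterS => w /(_ I) fin.
apply/summable_is_cvg_series => //.
by rewrite -ge0_fin_numE//; apply: nneseries_ge0 => k _ _; rewrite lee_fin.
Qed.

(** In the method, a, b and vv are the squared distances of x, u and the next v
    to the solution, t is the squared distance from x to the next u, D the
    infeasibility of the next v and Phi its violation of the sampled
    constraints. *)
Variables (alpha : nat -> R) (mu gamma c eta K : R).
Variables (a b t D Phi vv : nat -> Omega -> R).
Hypotheses (ma : forall k, measurable_fun [set: Omega] (a k))
  (mb : forall k, measurable_fun [set: Omega] (b k))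
  (mt : forall k, measurable_fun [set: Omega] (t k))
  (mD : forall k, measurable_fun [set: Omega] (D k))
  (mPhi : forall k, measurable_fun [set: Omega] (Phi k))
  (mvv : forall k, measurable_fun [set: Omega] (vv k)).
Hypotheses (a0 : forall k w, 0 <= a k w) (b0 : forall k w, 0 <= b k w)
  (t0 : forall k w, 0 <= t k w) (D0 : forall k w, 0 <= D k w)
  (Phi0 : forall k w, 0 <= Phi k w) (vv0 : forall k w, 0 <= vv k w).
Hypotheses (mu0 : 0 < mu) (gamma0 : 0 < gamma) (eta0 : 0 < eta)
  (K0 : 0 <= K) (eta_half : eta <= 1 / 2) (eta_gamma : 2 * eta * c <= gamma).
Hypotheses (al0 : forall k, 0 < alpha k)
  (alN : forall k, alpha k.+1 <= alpha k) (alD : ~ cvgn (series alpha))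
  (al2 : cvgn (series (fun k => alpha k ^+ 2))).
Hypotheses (ia0 : integ (a 0%N)) (ib0 : integ (b 0%N)).
Hypothesis descent : forall k w,
  vv k w + t k w + 3 / 2 * (alpha k * mu * b k.+1 w) <=
  a k w + alpha k * mu * b k w + K * alpha k ^+ 2 + eta * D k w.
Hypothesis feasible : forall k w, a k.+1 w + gamma * Phi k w <= vv k w.
Hypothesis D_le : forall k w, D k w <= vv k w.
Hypothesis a_le : forall k w, a k w <= 2 * b k.+1 w + 2 * t k w.
Hypothesis D_Phi :
  forall k, (\int[P]_w (D k w)%:E <= c%:E * \int[P]_w (Phi k w)%:E)%E.

Let Wbound k w := a k w + alpha k * mu * b k w + K * alpha k ^+ 2.

(** As D <= vv and eta <= 1 / 2, half of vv absorbs eta * D in the descent. *)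
Let Wbound_ge k w : [/\ vv k w <= 2 * Wbound k w, t k w <= 2 * Wbound k w
  & alpha k * mu * b k.+1 w <= 2 * Wbound k w].
Proof.
have ab0 : 0 <= alpha k * mu * b k.+1 w by rewrite !mulr_ge0// ltW.
have eD : eta * D k w <= 1 / 2 * vv k w by apply: ler_pM => //; exact: ltW.
have := descent k w; have := t0 k w; have := vv0 k w; rewrite /Wbound.
by split; lra.
Qed.

Let integ_Wbound k : integ (a k) -> integ (b k) -> integ (Wbound k).
Proof.
move=> ia ib; apply: integrable_addr; last exact: integrable_cstr.
by apply: integrable_addr => //; exact: integrable_scaler.
Qed.

Let integ_ab k : integ (a k) /\ integ (b k).
Proof.
elim: k => // k [ia ib]; have iW := integrable_scaler 2 (integ_Wbound ia ib); split.
  apply: integrable_dominated iW => // w.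
  have [vvW _ _] := Wbound_ge k w; apply: le_trans vvW.
  apply: le_trans (feasible k w); rewrite lerDl mulr_ge0//; exact: ltW.
have am : 0 < alpha k * mu by rewrite mulr_gt0.
apply: (integrable_dominated
  (g := fun w => (alpha k * mu)^-1 * (2 * Wbound k w))) => //.
  by move=> w; rewrite mulrC ler_pdivlMr// mulrC; have [] := Wbound_ge k w.
exact: integrable_scaler.
Qed.

Let ia k : integ (a k). Proof. by have [] := integ_ab k. Qed.
Let ib k : integ (b k). Proof. by have [] := integ_ab k. Qed.
Let iW k : integ (fun w => 2 * Wbound k w).
Proof. exact/integrable_scaler/integ_Wbound. Qed.
Let ivv k : integ (vv k).
Proof. by apply: integrable_dominated (iW k) => // w; have [] := Wbound_ge k w. Qed.
Let it k : integ (t k).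
Proof. by apply: integrable_dominated (iW k) => // w; have [] := Wbound_ge k w. Qed.
Let iD k : integ (D k). Proof. exact: integrable_dominated (ivv k). Qed.

Let iPhi k : integ (Phi k).
Proof.
apply: (integrable_dominated (g := fun w => gamma^-1 * vv k w)) => //.
  move=> w; rewrite mulrC ler_pdivlMr// mulrC; apply: le_trans (feasible k w).
  by rewrite lerDr.
exact: integrable_scaler.
Qed.

Local Notation "''Ex' f" := (\int[P]_w f w) (at level 10, f at level 9).

Let exp_descent k :
  'Ex (a k.+1) + 'Ex (t k) + 3 / 2 * (alpha k * mu * 'Ex (b k.+1))
     + eta * 'Ex (D k) <=
  'Ex (a k) + alpha k * mu * 'Ex (b k) + K * alpha k ^+ 2.
Proof.
have e1 : 'Ex (D k) <= c * 'Ex (Phi k).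
  by rewrite -lee_fin EFinM !EFin_Rintegral.
have e2 : 'Ex (a k.+1) + gamma * 'Ex (Phi k) <= 'Ex (vv k).
  rewrite -RintegralZl// -RintegralD//; last exact: integrable_scaler.
  apply: le_Rintegral => //.
  by apply: integrable_addr => //; exact: integrable_scaler.
have e3 : 'Ex (vv k) + 'Ex (t k) + 3 / 2 * (alpha k * mu * 'Ex (b k.+1)) <=
   'Ex (a k) + alpha k * mu * 'Ex (b k) + K * alpha k ^+ 2 + eta * 'Ex (D k).
  rewrite -{1}(RintegralZl (alpha k * mu))// -{1}(RintegralZl (3 / 2))//;
    last exact: integrable_scaler.
  rewrite -{1}RintegralD// -{1}RintegralD//; last 2 first.
  - exact: integrable_addr.
  - exact/integrable_scaler/integrable_scaler.
  rewrite -(RintegralZl (alpha k * mu))// -(RintegralZl eta)//.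
  rewrite -(Rintegral_probability_cst (K * alpha k ^+ 2)).
  rewrite -RintegralD//; last exact: integrable_scaler.
  rewrite -RintegralD//; last 2 first.
  - by apply: integrable_addr => //; exact: integrable_scaler.
  - exact: integrable_cstr.
  have iWb := integ_Wbound (ia k) (ib k).
  rewrite -RintegralD//; last exact: integrable_scaler.
  apply: le_Rintegral => //.
  - apply: integrable_addr; first exact: integrable_addr.
    exact/integrable_scaler/integrable_scaler.
  - by apply: integrable_addr => //; exact: integrable_scaler.
have e4 : 2 * eta * 'Ex (D k) <= gamma * 'Ex (Phi k).
  have Ephi : 0 <= 'Ex (Phi k) by exact: Rintegral_ge0.
  have : 2 * eta * 'Ex (D k) <= 2 * eta * (c * 'Ex (Phi k)).
    by rewrite ler_pM2l// mulr_gt0.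
  have : 2 * eta * c * 'Ex (Phi k) <= gamma * 'Ex (Phi k) by rewrite ler_wpM2r.
  lra.
lra.
Qed.

Let Ea0 k : 0 <= 'Ex (a k). Proof. exact: Rintegral_ge0. Qed.
Let Eb0 k : 0 <= 'Ex (b k). Proof. exact: Rintegral_ge0. Qed.
Let Et0 k : 0 <= 'Ex (t k). Proof. exact: Rintegral_ge0. Qed.
Let ED0 k : 0 <= 'Ex (D k). Proof. exact: Rintegral_ge0. Qed.
Let Kal k : 0 <= K * alpha k ^+ 2. Proof. by rewrite mulr_ge0 ?sqr_ge0. Qed.

Let cKal : cvgn (series (fun k => K * alpha k ^+ 2)).
Proof. exact: (@is_cvg_seriesZ _ _ K al2). Qed.

Lemma exp_a_le k : 'Ex (a k) <= 2 * 'Ex (b k.+1) + 2 * 'Ex (t k).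
Proof.
rewrite -!RintegralZl// -RintegralD//; try exact: integrable_scaler.
by apply: le_Rintegral => //; apply: integrable_addr; exact: integrable_scaler.
Qed.

Let Wexp_cvg0 : (fun k => 'Ex (a k) + alpha k * mu * 'Ex (b k)) @ \oo --> 0.
Proof.
apply: (lyapunov_cvg0 (t := fun k => 'Ex (t k)) (r := fun k => K * alpha k ^+ 2)
  (b := fun k => 'Ex (b k)) (a := fun k => 'Ex (a k)) mu0 al0 alN alD) => //.
  exact: exp_a_le.
move=> k; have := exp_descent k; have : 0 <= eta * 'Ex (D k).
  by rewrite mulr_ge0// ltW.
lra.
Qed.

Lemma summable_expected_infeasibility : cvgn (series (fun k => 'Ex (D k))).
Proof.
have am0 k l : 0 <= alpha k * mu * 'Ex (b l) by rewrite !mulr_ge0// ltW.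
have [_ h] : cvgn (fun k => 'Ex (a k) + alpha k * mu * 'Ex (b k)) /\
    cvgn (series (fun k => eta * 'Ex (D k))).
  apply: (quasi_fejer (r := fun k => K * alpha k ^+ 2)) => //.
  - by move=> k; rewrite addr_ge0.
  - by move=> k; rewrite mulr_ge0// ltW.
  move=> k; have := exp_descent k; have := Et0 k.
  have : alpha k.+1 * (mu * 'Ex (b k.+1)) <= alpha k * (mu * 'Ex (b k.+1)).
    by rewrite ler_wpM2r// mulr_ge0// ltW.
  by have := am0 k k.+1; lra.
move: h => /(@is_cvg_seriesZ _ _ eta^-1).
rewrite (_ : _ *: _ = fun k => 'Ex (D k))//; apply/funext => k.
change (eta^-1 * (eta * 'Ex (D k)) = 'Ex (D k)).
by rewrite mulKf// gt_eqF.
Qed.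

Lemma expected_square_cvg0 :
  [/\ forall k, integ (a k) /\ integ (vv k),
      (fun k => 'Ex (a k)) @ \oo --> 0 & (fun k => 'Ex (vv k)) @ \oo --> 0].
Proof.
have am0 k l : 0 <= alpha k * mu * 'Ex (b l) by rewrite !mulr_ge0// ltW.
have Kal_0 := cvg_series_cvg_0 cKal.
split => [//||].
  apply: (@squeeze_cvgr _ _ _ _ (fun=> 0) _ _ _ 0 _ Wexp_cvg0); last exact: cvg_cst.
  by apply: nearW => k; rewrite Ea0 lerDl am0.
have : (fun k => 2 * (('Ex (a k) + alpha k * mu * 'Ex (b k)) + K * alpha k ^+ 2))
    @ \oo --> (2 * (0 + 0) : R).
  by apply: cvgMl_tmp; apply: cvgD Kal_0; exact: Wexp_cvg0.
rewrite addr0 mulr0; apply: squeeze_cvgr; last exact: cvg_cst.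
apply: nearW => k; rewrite Rintegral_ge0//=.
have -> : 2 * ('Ex (a k) + alpha k * mu * 'Ex (b k) + K * alpha k ^+ 2) =
    \int[P]_w (2 * Wbound k w).
  rewrite RintegralZl//; last exact: integ_Wbound.
  rewrite RintegralD//; last exact: integrable_cstr.
    rewrite RintegralD//; last exact: integrable_scaler.
    by rewrite RintegralZl// Rintegral_probability_cst.
  by apply: integrable_addr => //; exact: integrable_scaler.
by apply: le_Rintegral => // w _; have [] := Wbound_ge k w.
Qed.

(** Once the infeasibilities are summable along a sample path, the path itself
    satisfies the deterministic recursion. *)
Lemma ae_square_cvg0 :
  {ae P, forall w, a k w @[k --> \oo] --> 0} /\
  {ae P, forall w, vv k w @[k --> \oo] --> 0}.
Proof.
have : {ae P, forall w, (a k w @[k --> \oo] --> 0) /\ (vv k w @[k --> \oo] --> 0)}.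
  have := ae_summable mD D0 iD summable_expected_infeasibility.
  apply: filterS => w cD.
  pose r k := K * alpha k ^+ 2 + eta * D k w.
  have r0 k : 0 <= r k by rewrite addr_ge0// mulr_ge0// ltW.
  have cr : cvgn (series r).
    rewrite /r (_ : series _ = series (fun k => K * alpha k ^+ 2) \+
                               series (fun k => eta * D k w)).
      by apply: is_cvgD => //; exact: (@is_cvg_seriesZ _ _ eta cD).
    by apply/funext => k; rewrite /series/= big_split.
  have am0 k l : 0 <= alpha k * mu * b l w by rewrite !mulr_ge0// ltW.
  have W_0 : (fun k => a k w + alpha k * mu * b k w) @ \oo --> 0.
    apply: (lyapunov_cvg0 (t := t ^~ w) (r := r) mu0 al0 alN alD) => //.
    move=> k; have := descent k w; have := feasible k w; rewrite /r.
    have : 0 <= gamma * Phi k w by rewrite mulr_ge0// ltW.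
    lra.
  split.
    apply: (@squeeze_cvgr _ _ _ _ (fun=> 0) _ _ _ 0 _ W_0); last exact: cvg_cst.
    by apply: nearW => k; rewrite a0 lerDl am0.
  have : (fun k => a k w + alpha k * mu * b k w + r k) @ \oo --> (0 + 0 : R).
    by apply: cvgD (cvg_series_cvg_0 cr); exact: W_0.
  rewrite addr0; apply: squeeze_cvgr; last exact: cvg_cst.
  apply: nearW => k; rewrite vv0 /=.
  have := descent k w; have := am0 k k.+1; have := t0 k w; rewrite /r; lra.
by move=> h; split; apply: filterS h => w [].
Qed.

End StochasticLyapunov.

Section SquareRoots.
Context {R : realType}.

Lemma cvg0_of_sqr (f : nat -> R) : (forall k, 0 <= f k) ->
  (fun k => f k ^+ 2) @ \oo --> 0 -> f @ \oo --> 0.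
Proof.
move=> f0 /cvgrPdist_lt h; apply/cvgrPdist_lt => e e0.
have e2 : 0 < e ^+ 2 by rewrite exprn_gt0.
apply: filterS (h _ e2) => k; rewrite !sub0r !normrN !ger0_norm ?sqr_ge0//.
by rewrite ltr_pXn2r ?nnegrE ?(ltW e0).
Qed.

(** The mean square controls the mean through f <= e / 2 + f ^ 2 / (2 e), where
    e is free. *)
Lemma expectation_cvg0 {dO : measure_display} {Omega : measurableType dO}
    (P : probability Omega R) (f s : nat -> Omega -> R) :
  (forall k, measurable_fun [set: Omega] (f k)) -> (forall k w, 0 <= f k w) ->
  (forall k w, f k w ^+ 2 <= s k w) ->
  (forall k, P.-integrable [set: Omega] (EFin \o s k)) ->
  (fun k => \int[P]_w s k w) @ \oo --> 0 ->
  (fun k => 'E_P[f k]%E) @ \oo --> 0%E.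
Proof.
move=> mf f0 fs is_ s_0.
have bound (e : R) k w : 0 < e -> f k w <= e / 2 + (2 * e)^-1 * s k w.
  move=> e0; have h : 0 <= (f k w - e) ^+ 2 by exact: sqr_ge0.
  have e2 : 0 < 2 * e by lra.
  apply: (@le_trans _ _ (e / 2 + (2 * e)^-1 * f k w ^+ 2)); last first.
    by rewrite lerD2l ler_wpM2l// invr_ge0 ltW.
  have -> : e / 2 + (2 * e)^-1 * f k w ^+ 2 = (e ^+ 2 + f k w ^+ 2) / (2 * e).
    by field; rewrite gt_eqF.
  rewrite ler_pdivlMr//; move: h; rewrite sqrrB -mulr_natl; lra.
have ibound e k : P.-integrable [set: Omega]
    (EFin \o (fun w => e / 2 + (2 * e)^-1 * s k w)).
  apply: integrable_addr; first exact: integrable_cstr.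
  exact: integrable_scaler.
have if_ k : P.-integrable [set: Omega] (EFin \o f k).
  by apply: integrable_dominated (ibound 1 k) => // w; exact: bound.
have -> : (fun k => 'E_P[f k]%E) = (fun k => (\int[P]_w f k w)%:E).
  by apply/funext => k; rewrite unlock EFin_Rintegral.
apply: cvg_EFin; first by apply: nearW => k.
apply/cvgrPdist_le => e e0; move/cvgrPdist_le : s_0 => s_0.
have e2 : 0 < e ^+ 2 by rewrite exprn_gt0.
apply: filterS (s_0 _ e2) => k; rewrite !sub0r !normrN /= => sk.
rewrite ger0_norm ?Rintegral_ge0//.
apply: (@le_trans _ _ (\int[P]_w (e / 2 + (2 * e)^-1 * s k w))).
  by apply: le_Rintegral => // w _; exact: bound.
rewrite RintegralD//; [|exact: integrable_cstr|exact: integrable_scaler].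
rewrite Rintegral_probability_cst RintegralZl//.
have : (2 * e)^-1 * \int[P]_w s k w <= (2 * e)^-1 * e ^+ 2.
  rewrite ler_wpM2l ?invr_ge0//; first by rewrite mulr_ge0// ltW.
  exact: le_trans (ler_norm _) sk.
have -> : (2 * e)^-1 * e ^+ 2 = e / 2 by field; rewrite gt_eqF.
lra.
Qed.

End SquareRoots.

(** * The random feasibility steps and the history of the method *)

Section FeasibilitySteps.
Context {R : realType} {m : nat} {A : Type}.
Variables (Y : set 'rV[R]_m) (g : A -> 'rV[R]_m -> R) (M beta : R).
Hypothesis Ycl : closed Y.
Hypothesis Y0 : Y !=set0.
Hypothesis Ycvx : convex_set Y.
Hypothesis gc : forall a, convex_function [set: convex_lmodType 'rV[R]_m] (g a).
Hypothesis M0 : 0 < M.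
Hypothesis subgrad_le :
  forall a y e, Y y -> subdifferential (g a) y e -> eucl e <= M.
Hypothesis beta02 : 0 < beta < 2.

Lemma feasibility_steps_in d0 N a d z (input output : 'rV[R]_m) :
  Y input -> feasibility_steps Y g beta d0 N a d z input output ->
  (forall i, (i <= N)%N -> Y (z i)) /\ Y output.
Proof.
move=> Yin [z0 zS ->].
have Yz i : (i <= N)%N -> Y (z i).
  by case: i => [|i] iN; [rewrite z0|have [//|_ ->] := zS i.+1; exact: proj_in].
by split => //; exact: Yz.
Qed.

(** No step moves away from y.  The gain is read off the first one, whose
    starting point is the input and thus known before any index is drawn. *)
Lemma feasibility_steps_decrease d0 N a d z (input output y : 'rV[R]_m) :
  (0 < N)%N -> Y input -> Y y -> (forall a, g a y <= 0) ->
  feasibility_steps Y g beta d0 N a d z input output ->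
  eucl (output - y) ^+ 2 + beta * (2 - beta) / M ^+ 2 * (g (a 1%N))^\+ input ^+ 2
    <= eucl (input - y) ^+ 2.
Proof.
move=> N0 Yin Yy gy fs; have [Yz _] := feasibility_steps_in Yin fs.
have [z0 zS ->] := fs.
have step i : (i < N)%N -> eucl (z i.+1 - y) ^+ 2 <=
    eucl (z i - y) ^+ 2 - beta * (2 - beta) / M ^+ 2 * (g (a i.+1))^\+ (z i) ^+ 2.
  move=> iN; have [//|dP zE] := zS i.+1.
  exact: (feasibility_step_decrease (gc _) (@subgrad_le _) Ycl Ycvx M0 beta02
           (Yz i (ltnW iN)) Yy (gy _) dP zE).
have gamma0 : 0 <= beta * (2 - beta) / M ^+ 2.
  by move/andP: beta02 => [b0 b2]; rewrite divr_ge0 ?sqr_ge0// mulr_ge0//; lra.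
have mono i : (1 <= i <= N)%N -> eucl (z i - y) ^+ 2 <= eucl (z 1%N - y) ^+ 2.
  elim: i => // -[//|i] IH /andP[_ iN].
  apply: le_trans (IH _); last by rewrite /= ltnW.
  apply: le_trans (step _ iN) _; rewrite gerBl mulr_ge0// sqr_ge0.
  by [].
have := mono N; rewrite N0 leqnn => /(_ isT).
have := step 0%N N0; rewrite z0; lra.
Qed.

End FeasibilitySteps.

Section FeasibilityMeasurability.
Context {R : realType} {m : nat} {dA : measure_display} {A : measurableType dA}.
Context {d : measure_display} {T : measurableType d}.
Variables (Y : set 'rV[R]_m) (g : A -> 'rV[R]_m -> R) (M beta : R).
Hypothesis Ycl : closed Y.
Hypothesis Y0 : Y !=set0.
Hypothesis Ycvx : convex_set Y.
Hypothesis gc : forall a, convex_function [set: convex_lmodType 'rV[R]_m] (g a).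
Hypothesis subgrad_le :
  forall a y e, Y y -> subdifferential (g a) y e -> eucl e <= M.
Hypothesis g_meas : forall y, Y y -> measurable_fun [set: A] (g ^~ y).

Lemma measurable_violation (om : T -> A) (V : T -> 'rV[R]_m) :
  measurable_fun [set: T] om -> (forall w, Y (V w)) -> random_vector V ->
  measurable_fun [set: T] (fun w => (g (om w))^\+ (V w)).
Proof.
move=> mom VY mV.
apply: (@measurable_comp_random_vector _ _ _ _ _ _ mV VY Y0
         (fun w => (g (om w))^\+)).
  move=> y Yy; apply: (@measurable_maxr _ _ _ _ (fun w => g (om w) y) (fun=> 0)) => //.
  exact: measurableT_comp (g_meas Yy) mom.
move=> w; exists M => y z Yy Yz.
exact: (pos_part_lipschitz (gc (om w)) (@subgrad_le (om w)) Yy Yz).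
Qed.

Lemma random_vector_feasibility_steps d0 N (a : nat -> T -> A)
    (dir z : nat -> T -> 'rV[R]_m) (input output : T -> 'rV[R]_m) :
  (forall w, Y (input w)) ->
  (forall w, feasibility_steps Y g beta d0 N (a ^~ w) (dir ^~ w) (z ^~ w)
     (input w) (output w)) ->
  random_vector input ->
  (forall i, (1 <= i <= N)%N -> measurable_fun [set: T] (a i)) ->
  (forall i, (1 <= i <= N)%N -> random_vector (dir i)) ->
  random_vector output.
Proof.
move=> Yin fs min_ ma mdir.
have Yz i w : (i <= N)%N -> Y (z i w).
  by move=> iN; have [h _] := feasibility_steps_in Ycl Y0 (Yin w) (fs w); exact: h.
have mz i : (i <= N)%N -> random_vector (z i).
  elim: i => [_|i IH iN].
    by rewrite (_ : z 0%N = input)//; apply/funext => w; have [] := fs w.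
  have mzi := IH (ltnW iN).
  pose s w := beta * ((g (a i.+1 w))^\+ (z i w) / eucl (dir i.+1 w) ^+ 2).
  rewrite (_ : z i.+1 = fun w => proj Y (z i w - s w *: dir i.+1 w)); last first.
    by apply/funext => w; have [_ /(_ i.+1 iN)[]] := fs w.
  apply: random_vector_proj => //; apply: random_vectorB => //.
  apply: random_vectorZ; last exact: mdir.
  apply: measurable_funM => //; apply: measurable_funM.
    by apply: measurable_violation => //; [exact: ma|move=> w; exact/Yz/ltnW].
  apply: measurable_inv_ge0 => [w|]; first exact: sqr_ge0.
  exact/measurable_eucl_sqr/mdir.
by rewrite (_ : output = z N); [exact: mz|apply/funext => w; have [] := fs w].
Qed.

End FeasibilityMeasurability.

Section History.
Context {R : realType} {dO : measure_display} {Omega : measurableType dO}.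
Context {J : nat} {n : 'I_J -> nat} {dA : 'I_J -> measure_display}
  {A : forall j : 'I_J, measurableType (dA j)}.
Variables (N : nat -> 'I_J -> nat)
  (x0 u0 : Omega -> 'rV[R]_(\sum_(j < J) n j))
  (omega : nat -> forall j : 'I_J, nat -> Omega -> A j)
  (d : nat -> forall j : 'I_J, nat -> Omega -> 'rV[R]_(n j)).

Local Notation H := (history N x0 u0 omega d).

Lemma history_mono k l : (k <= l)%N -> H k `<=` H l.
Proof.
move=> kl B [h|[i /= /andP[i1 ik] h]]; [by left|right].
by exists i => //=; rewrite i1 (leq_trans ik kl).
Qed.

Lemma preimage_system_measurable d1 d2 (T : measurableType d1) (U : measurableType d2)
    (f : T -> U) : measurable_fun [set: T] f ->
  preimage_set_system [set: T] f measurable `<=` measurable.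
Proof. by move=> mf _ [B mB <-]; exact: mf. Qed.

Lemma vector_events_measurable m (X : Omega -> 'rV[R]_m) :
  random_vector X -> vector_events X `<=` measurable.
Proof. by move=> mX B [i _]; exact: preimage_system_measurable. Qed.

Lemma history_measurable k :
  random_vector x0 -> random_vector u0 ->
  (forall l j i, (1 <= l)%N -> (1 <= i <= N l j)%N ->
     measurable_fun [set: Omega] (omega l j i)) ->
  (forall l j i, (1 <= l)%N -> (1 <= i <= N l j)%N -> random_vector (d l j i)) ->
  H k `<=` measurable.
Proof.
move=> mx0 mu0 mom md B [[|]|].
- exact: vector_events_measurable.
- exact: vector_events_measurable.
move=> [l /= /andP[l1 _]] [j _] [i /= iN] [|].
- by apply: preimage_system_measurable; exact: mom.
- by apply: vector_events_measurable; exact: md.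
Qed.

Lemma measurable_of_preimages (G : set (set Omega)) d2 (U : measurableType d2)
    (f : Omega -> U) : preimage_set_system [set: Omega] f measurable `<=` G ->
  measurable_fun [set: g_sigma_algebraType G] f.
Proof. by move=> fG _ B mB; apply: sub_sigma_algebra; apply: fG; exists B. Qed.

Lemma random_vector_of_events (G : set (set Omega)) m (X : Omega -> 'rV[R]_m) :
  vector_events X `<=` G -> @random_vector R _ (g_sigma_algebraType G) m X.
Proof.
move=> XG i; apply: measurable_of_preimages => B h; apply: XG.
by exists i.
Qed.

Lemma random_vector_sub_sigma_algebra (G G' : set (set Omega)) m
    (X : Omega -> 'rV[R]_m) : G `<=` G' ->
  @random_vector R _ (g_sigma_algebraType G) m X ->
  @random_vector R _ (g_sigma_algebraType G') m X.
Proof.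
move=> GG' mX i _ B mB; apply: (@sub_sigma_algebra2 Omega [set: Omega] G' G GG').
exact: (mX i measurableT B mB).
Qed.

Lemma random_vector_initial k :
  @random_vector R _ (g_sigma_algebraType (H k)) _ x0 /\
  @random_vector R _ (g_sigma_algebraType (H k)) _ u0.
Proof.
by split; apply: random_vector_of_events => B h; left; [left|right].
Qed.

Lemma history_step k j i : (1 <= k)%N -> (1 <= i <= N k j)%N ->
  measurable_fun [set: g_sigma_algebraType (H k.+1)] (omega k j i) /\
  @random_vector R _ (g_sigma_algebraType (H k.+1)) _ (d k j i).
Proof.
move=> k1 iN; split; [apply: measurable_of_preimages|apply: random_vector_of_events];
  move=> B h; right; exists k; rewrite /= ?k1 ?ltnSn//; exists j => //; exists i => //;
  by [left|right].
Qed.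

End History.

(** * Popov steps over a product of sets *)

Section PopovMethod.
Context {R : realType}.

Lemma eucl_sqr_triangleB {m : nat} (y x z : 'rV[R]_m) :
  eucl (x - z) ^+ 2 <= 2 * eucl (y - z) ^+ 2 + 2 * eucl (x - y) ^+ 2.
Proof.
rewrite !eucl_sqr; have := dot_ge0 ((x - y) - (y - z)).
rewrite !dotE (dotC y x) (dotC z x) (dotC z y); lra.
Qed.

(** Compare v, block by block, with nearly nearest feasible points: at these the
    variational inequality holds exactly. *)
Lemma VI_solution_defect {J : nat} {n : 'I_J -> nat}
    (S : forall j : 'I_J, set 'rV[R]_(n j))
    (F : 'rV[R]_(\sum_(j < J) n j) -> 'rV[R]_(\sum_(j < J) n j)) xs v :
  (forall j, S j !=set0) -> VI_solution (product_set S) F xs ->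
  dot (F xs) (xs - v) <=
    \sum_(j < J) eucl (submxrow (F xs) j) * dist (submxrow v j) (S j).
Proof.
move=> S0 [_ VI]; set Fs := F xs in VI *.
apply/ler_addgt0Pr => e e0.
pose C : R := \sum_(j < J) eucl (submxrow Fs j).
have C0 : 0 <= C by apply: sumr_ge0 => j _; exact: eucl_ge0.
pose e' := e / (C + 1).
have C1 : 0 < C + 1 by lra.
have e'0 : 0 < e' by rewrite divr_gt0.
have ye j : exists y, S j y /\ eucl (submxrow v j - y) < dist (submxrow v j) (S j) + e'.
  by have [y Sy h] := dist_approx (S0 j) (submxrow v j) e'0; exists y.
pose yj j := xget 0 [set y | S j y /\
  eucl (submxrow v j - y) < dist (submxrow v j) (S j) + e'].
have yjP j : S j (yj j) /\ eucl (submxrow v j - yj j) < dist (submxrow v j) (S j) + e'.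
  by have [y yP] := ye j; exact: (@xgetI _ 0 [set y | S j y /\ _ < _] y yP).
pose y : 'rV[R]_(\sum_(j < J) n j) := \mxrow_j yj j.
have Sy : product_set S y by move=> j; rewrite mxrowK; have [] := yjP j.
have -> : dot Fs (xs - v) = dot Fs (y - v) - dot Fs (y - xs).
  by rewrite !dotE; ring.
have h1 := VI y Sy.
have h2 : dot Fs (y - v) <= \sum_(j < J) eucl (submxrow Fs j) *
    (dist (submxrow v j) (S j) + e').
  rewrite dot_blocks; apply: ler_sum => j _.
  rewrite submxrowB mxrowK (le_trans (dot_le_eucl _ _))// ler_wpM2l ?eucl_ge0//.
  by rewrite euclC ltW//; have [] := yjP j.
have h3 : \sum_(j < J) eucl (submxrow Fs j) * (dist (submxrow v j) (S j) + e') =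
    \sum_(j < J) eucl (submxrow Fs j) * dist (submxrow v j) (S j) + C * e'.
  by rewrite /C mulr_suml -big_split; apply: eq_bigr => j _; rewrite mulrDr.
have h4 : C * e' <= e by rewrite mulrA ler_pdivrMr// mulrC ler_pM2l//; lra.
lra.
Qed.

Lemma measurable_lipschitz_comp {d : measure_display} {T : measurableType d}
    {m : nat} (f : 'rV[R]_m -> R) (V : T -> 'rV[R]_m) :
  random_vector V -> (forall y z, `|f y - f z| <= eucl (y - z)) ->
  measurable_fun [set: T] (f \o V).
Proof.
move=> mV fL; apply: (@measurable_comp_random_vector _ _ _ _ [set: _] _ mV _ _
  (fun _ => f)) => //; first by exists 0.
by move=> w; exists 1 => y z _ _; rewrite mul1r.
Qed.


Section PopovStep.
Context {J : nat} {n : 'I_J -> nat}.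
Variables (Y S : forall j : 'I_J, set 'rV[R]_(n j))
  (F : 'rV[R]_(\sum_(j < J) n j) -> 'rV[R]_(\sum_(j < J) n j)) (L mu : R).
Arguments Y : clear implicits.
Arguments S : clear implicits.
Hypothesis Ycl : forall j : 'I_J, closed (Y j).
Hypothesis Y0 : forall j : 'I_J, Y j !=set0.
Hypothesis Ycvx : forall j : 'I_J, convex_set (Y j).
Hypothesis F_lip : forall y y', product_set Y y -> product_set Y y' ->
  eucl (F y - F y') <= L * eucl (y - y').

Lemma popov_step_in a x u' u v :
  popov_step Y F a x u' u v -> product_set Y u /\ product_set Y v.
Proof.
by move=> st; split => j; have [uE vE] := st j; rewrite ?uE ?vE; exact: proj_in.
Qed.

Lemma random_vector_popov_step {d : measure_display} {T : measurableType d} a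
    (x u' u v : T -> 'rV[R]_(\sum_(j < J) n j)) :
  (forall w, popov_step Y F a (x w) (u' w) (u w) (v w)) ->
  (forall w, product_set Y (u' w)) ->
  random_vector x -> random_vector u' -> random_vector u /\ random_vector v.
Proof.
move=> st u'Y mx mu'.
have YP0 : product_set Y !=set0.
  pose y j : 'rV[R]_(n j) := xget 0 (Y j).
  exists (\mxrow_j y j) => j; rewrite mxrowK.
  by have [z Yz] := Y0 j; exact: xgetI Yz.
have half (U W : T -> 'rV[R]_(\sum_(j < J) n j)) :
    (forall w, product_set Y (U w)) -> random_vector U ->
    (forall w j, submxrow (W w) j =
       proj (Y j) (submxrow (x w) j - a *: submxrow (F (U w)) j)) ->
    random_vector W.
  move=> UY mU WE; apply/random_vector_blocks => j.
  rewrite (_ : (fun w => _) = fun w =>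
    proj (Y j) (submxrow (x w) j - a *: submxrow (F (U w)) j)); last exact/funext.
  apply: random_vector_proj => //; apply: random_vectorB.
    exact: (random_vector_blocks _).1 mx j.
  apply: random_vectorZ; first exact: measurable_cst.
  exact: (random_vector_blocks _).1 (random_vector_comp YP0 UY mU F_lip) j.
have mru : random_vector u by apply: (half u') => // w j; have [] := st w j.
split => //; apply: (half u) => // w j; last by have [] := st w j.
by have [] := popov_step_in (st w).
Qed.

Hypothesis S0 : forall j : 'I_J, S j !=set0.
Hypothesis SY : forall j : 'I_J, S j `<=` Y j.
Hypothesis F_mono : forall y y', product_set Y y -> product_set Y y' ->
  mu * eucl (y - y') ^+ 2 <= dot (F y - F y') (y - y').

(** The defect of v in the variational inequality costs 2 * a times a distance
    to the feasible set; Young's inequality trades it for an arbitrarily small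
    multiple eta of the squared distance and an error of order a ^ 2, summable
    along the step sizes. *)
Lemma popov_step_descent a eta xs x u' u v :
  0 < a -> 0 < mu -> 0 < L -> a * L ^+ 2 <= mu / 8 -> 0 < eta ->
  VI_solution (product_set S) F xs -> product_set Y u' ->
  popov_step Y F a x u' u v ->
  eucl (v - xs) ^+ 2 + eucl (x - u) ^+ 2 + 3 / 2 * (a * mu * eucl (u - xs) ^+ 2)
  <= eucl (x - xs) ^+ 2 + a * mu * eucl (u' - xs) ^+ 2
     + (8 + eta^-1) * eucl (F xs) ^+ 2 * a ^+ 2
     + eta * \sum_(j < J) dist (submxrow v j) (S j) ^+ 2.
Proof.
move=> a0 mu0 L0 aL eta0 sol u'Y st.
have [uY vY] := popov_step_in st.
have xsY : product_set Y xs by move=> j; apply: SY; have [xsS _] := sol; exact: xsS.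
have hv : dot (x - a *: F u - v) (xs - v) <= 0.
  apply: (@block_proj_obtuse _ _ _ Y) => // j.
  by rewrite submxrowB submxrowZ; have [] := st j.
have hu : dot (x - a *: F u' - u) (v - u) <= 0.
  apply: (@block_proj_obtuse _ _ _ Y) => // j.
  by rewrite submxrowB submxrowZ; have [] := st j.
have hlip : eucl (F u - F u') ^+ 2 <= L ^+ 2 * eucl (u - u') ^+ 2.
  rewrite -exprMn lerXn2r ?nnegrE ?mulr_ge0 ?eucl_ge0 ?(ltW L0)//.
  exact: F_lip.
have := popov_inequality a0 mu0 aL hv hu hlip (F_mono uY xsY)
  (VI_solution_defect v S0 sol).
set Fs := F xs.
pose r := \sum_(j < J) eucl (submxrow Fs j) * dist (submxrow v j) (S j).
rewrite -/r => h.
suff : 2 * a * r <= eta * \sum_(j < J) dist (submxrow v j) (S j) ^+ 2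
                    + eta^-1 * eucl Fs ^+ 2 * a ^+ 2 by lra.
rewrite eucl_sqr_blocks /r [_ * _ * a ^+ 2]mulrAC !mulr_sumr -big_split.
apply: ler_sum => j _ /=; set p := eucl _; set s := dist _ _.
have ei : eta * eta^-1 = 1 by rewrite mulfV// gt_eqF.
have : 0 <= eta^-1 * (eta * s - a * p) ^+ 2.
  by rewrite mulr_ge0 ?sqr_ge0// invr_ge0 ltW.
have -> : eta^-1 * (eta * s - a * p) ^+ 2 =
   (eta * eta^-1) * (eta * s ^+ 2) - (eta * eta^-1) * (2 * a * (p * s))
   + eta^-1 * a ^+ 2 * p ^+ 2 by ring.
rewrite ei; lra.
Qed.

End PopovStep.

Lemma integrable_eucl_sqr_sub {dO : measure_display} {Omega : measurableType dO}
    (P : probability Omega R) {J : nat} {n : 'I_J -> nat}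
    (X : Omega -> 'rV[R]_(\sum_(j < J) n j)) y :
  random_vector X ->
  (forall j, ('E_P[(fun w => eucl (submxrow (X w) j) ^+ 2)%R] < +oo)%E) ->
  P.-integrable [set: Omega] (EFin \o (fun w => eucl (X w - y) ^+ 2)).
Proof.
move=> mX XL2.
have iX : P.-integrable [set: Omega] (EFin \o (fun w => eucl (X w) ^+ 2)).
  have -> : EFin \o (fun w => eucl (X w) ^+ 2) =
      (fun w => \sum_(j < J) (eucl (submxrow (X w) j) ^+ 2)%:E)%E.
    by apply/funext => w /=; rewrite eucl_sqr_blocks sumEFin.
  apply: integrable_sum => // j _; apply: integrable_ge0_lty.
  - exact/measurable_eucl_sqr/(random_vector_blocks _).1.
  - by move=> w; exact: sqr_ge0.
  - by have := XL2 j; rewrite unlock.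
apply: (integrable_dominated (g := fun w => 2 * eucl y ^+ 2 + 2 * eucl (X w) ^+ 2)).
- by apply/measurable_eucl_sqr/random_vectorB => //; exact: random_vector_cst.
- by move=> w; exact: sqr_ge0.
- move=> w; have := eucl_sqr_triangleB 0 (X w) y.
  by rewrite sub0r euclN subr0.
- by apply: integrable_addr; [exact: integrable_cstr|exact: integrable_scaler].
Qed.

End PopovMethod.

(** * Convergence of the modified Popov method *)

Theorem theorem6p2 (R : realType)
  (dO : measure_display) (Omega : measurableType dO) (P : probability Omega R)
  (* agents, sets, constraints, mapping *)
  (J : nat) (hJ : (1 <= J)%N) (n : 'I_J -> nat)
  (Y : forall j : 'I_J, set 'rV[R]_(n j))
  (dA : 'I_J -> measure_display) (A : forall j : 'I_J, measurableType (dA j))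
  (g : forall j : 'I_J, A j -> 'rV[R]_(n j) -> R)
  (F : 'rV[R]_(\sum_(j < J) n j) -> 'rV[R]_(\sum_(j < J) n j))
  (* parameters of the method *)
  (alpha : nat -> R) (beta : R) (N : nat -> 'I_J -> nat)
  (d0 : forall j : 'I_J, 'rV[R]_(n j))
  (* the random sequences *)
  (x u v : nat -> Omega -> 'rV[R]_(\sum_(j < J) n j))
  (omega : nat -> forall j : 'I_J, nat -> Omega -> A j)
  (d z : nat -> forall j : 'I_J, nat -> Omega -> 'rV[R]_(n j))
  (* constants *)
  (M_g L mu c tau nu q : R) (zeta : nat -> R)
  (S := fun j : 'I_J => constraint_set (g j) `&` Y j)
  (* the method *)
  (hbeta : 0 < beta < 2)
  (hN : forall (k : nat) (j : 'I_J), (1 <= k)%N -> (1 <= N k j)%N)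
  (hd0 : forall j : 'I_J, d0 j != 0)
  (hx0 : random_vector (x 0%N)) (hx0Y : forall w, product_set Y (x 0%N w))
  (hx0L2 : forall j : 'I_J,
    ('E_P[(fun w => eucl (submxrow (x 0%N w) j) ^+ 2)%R] < +oo)%E)
  (hu0 : random_vector (u 0%N)) (hu0Y : forall w, product_set Y (u 0%N w))
  (hu0L2 : forall j : 'I_J,
    ('E_P[(fun w => eucl (submxrow (u 0%N w) j) ^+ 2)%R] < +oo)%E)
  (hpopov : forall (k : nat) (w : Omega), (1 <= k)%N ->
    popov_step Y F (alpha k.-1) (x k.-1 w) (u k.-1 w) (u k w) (v k w))
  (hfeas : forall (k : nat) (j : 'I_J) (w : Omega), (1 <= k)%N ->
    feasibility_steps (Y j) (g j) beta (d0 j) (N k j)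
      (fun i => omega k j i w) (fun i => d k j i w) (fun i => z k j i w)
      (submxrow (v k w) j) (submxrow (x k w) j))
  (homega : forall (k : nat) (j : 'I_J) (i : nat),
    (1 <= k)%N -> (1 <= i <= N k j)%N ->
    measurable_fun [set: Omega] (omega k j i))
  (hd : forall (k : nat) (j : 'I_J) (i : nat),
    (1 <= k)%N -> (1 <= i <= N k j)%N -> random_vector (d k j i))
  (hg_meas : forall (j : 'I_J) (y : 'rV[R]_(n j)), Y j y ->
    measurable_fun [set: A j] (fun a => g j a y))
  (* (a) *)
  (hY_closed : forall j : 'I_J, closed (Y j))
  (hY_convex : forall j : 'I_J, convex_set (Y j))
  (hS : forall j : 'I_J, S j !=set0)
  (hg_convex : forall (j : 'I_J) (a : A j),
    convex_function [set: convex_lmodType 'rV[R]_(n j)] (g j a))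
  (* (b) *)
  (hM_g : 0 < M_g)
  (hsubgrad : forall (j : 'I_J) (a : A j) (y e : 'rV[R]_(n j)),
    Y j y -> subdifferential (g j a) y e -> eucl e <= M_g)
  (* (c) *)
  (hL : 0 < L)
  (hF_lip : forall y y', product_set Y y -> product_set Y y' ->
    eucl (F y - F y') <= L * eucl (y - y'))
  (* (d) *)
  (hmu : 0 < mu)
  (hF_mono : forall y y', product_set Y y -> product_set Y y' ->
    mu * eucl (y - y') ^+ 2 <= dot (F y - F y') (y - y'))
  (* (e) *)
  (hc : 0 < c)
  (hreg : forall (k : nat) (j : 'I_J) (i : nat) (y : 'rV[R]_(n j)),
    (1 <= k)%N -> (1 <= i <= N k j)%N -> Y j y ->
    cond_expectation_ge P (history N (x 0%N) (u 0%N) omega d k) c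
      (fun w => ((g j (omega k j i w))^\+ y) ^+ 2) (dist y (S j) ^+ 2))
  (* (f) *)
  (halpha_gt0 : forall k, 0 < alpha k)
  (halpha_sum : (\sum_(0 <= k <oo) (alpha k)%:E = +oo)%E)
  (halpha_sum2 : (\sum_(0 <= k <oo) (alpha k ^+ 2)%:E < +oo)%E)
  (halpha_noninc : forall k, alpha k.+1 <= alpha k)
  (htau : 2 < tau) (hnu : 1 < nu)
  (halpha_le : forall k, alpha k <=
    Num.min (mu / (4 * tau * L ^+ 2))
      (Num.min ((1 - 2 / tau) / (2 * L / tau + L * tau))
               ((1 - 1 / nu) / (2 * mu + L * tau))))
  (* (g) *)
  (hq : q = beta * (2 - beta) / (c * M_g ^+ 2))
  (hzeta : forall k, zeta k =
    q / (1 - q) * (1 - alpha k * mu + 2 * tau * L ^+ 2 * alpha k ^+ 2))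
  (* the solution *)
  (xstar : 'rV[R]_(\sum_(j < J) n j))
  (hxstar : VI_solution (product_set S) F xstar) :
  [/\ forall (k : nat) (w : Omega), product_set Y (x k w) /\
        ((1 <= k)%N -> product_set Y (v k w)),
      {ae P, forall w, eucl (x k w - xstar) @[k --> \oo] --> 0} /\
      {ae P, forall w, eucl (v k w - xstar) @[k --> \oo] --> 0},
      (fun k => 'E_P[(fun w => eucl (x k w - xstar))%R]%E) @ \oo --> 0%E /\
      (fun k => 'E_P[(fun w => eucl (v k w - xstar))%R]%E) @ \oo --> 0%E,
      {ae P, forall w, dist (x k w) (product_set S) @[k --> \oo] --> 0}
    & (fun k => 'E_P[fun w => dist (x k w) (product_set S)]%E) @ \oo --> 0%E].
Proof.
have [xsS VI] := hxstar.
have Y0 j : Y j !=set0 by have [y [_ Yy]] := hS j; exists y.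
have xsY : product_set Y xstar by move=> j; have [] := xsS j.
have S0 j : S j !=set0 by exact: hS.
have step k w : popov_step Y F (alpha k) (x k w) (u k w) (u k.+1 w) (v k.+1 w).
  exact: (hpopov k.+1).
have uvY k w : product_set Y (u k.+1 w) /\ product_set Y (v k.+1 w).
  exact: popov_step_in (step k w).
have vY k w : product_set Y (v k.+1 w) by have [] := uvY k w.
have uY k w : product_set Y (u k w).
  by case: k => [|k]; [exact: hu0Y|have [] := uvY k w].
have xY k w : product_set Y (x k w).
  case: k => [|k]; first exact: hx0Y.
  move=> j; have [] // := feasibility_steps_in (@hY_closed j) (Y0 j)
    (vY k w j) (hfeas k.+1 j w isT).
(* u k.+1 and v k.+1 are functions of the history H k.+1, whereas x k.+1 also
   depends on the draws of iteration k.+1 and hence on H k.+2 *)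
pose H := history N (x 0%N) (u 0%N) omega d.
have Hm k : H k `<=` measurable by exact: history_measurable.
have popov_meas k (G : set (set Omega)) :
    @random_vector R _ (g_sigma_algebraType G) _ (x k) ->
    @random_vector R _ (g_sigma_algebraType G) _ (u k) ->
    @random_vector R _ (g_sigma_algebraType G) _ (u k.+1) /\
    @random_vector R _ (g_sigma_algebraType G) _ (v k.+1).
  move=> mx mu_; apply: (@random_vector_popov_step R J n Y F L hY_closed Y0
    hY_convex hF_lip _ (g_sigma_algebraType G) (alpha k) (x k) (u k)
    (u k.+1) (v k.+1) _ _ mx mu_) => w; [exact: step|exact: uY].
have meas k : @random_vector R _ (g_sigma_algebraType (H k.+1)) _ (x k) /\
              @random_vector R _ (g_sigma_algebraType (H k.+1)) _ (u k).
  elim: k => [|k [mx mu_]]; first exact: random_vector_initial.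
  have [mu1 mv1] := popov_meas k _ mx mu_.
  have H12 : H k.+1 `<=` H k.+2 by exact: history_mono.
  split; last exact: random_vector_sub_sigma_algebra mu1.
  apply/random_vector_blocks => j.
  have mvj := (random_vector_blocks _).1 (random_vector_sub_sigma_algebra H12 mv1) j.
  apply: (@random_vector_feasibility_steps R (n j) _ _ _
    (g_sigma_algebraType (H k.+2)) (Y j) (@g j) M_g beta _ _ _ _ _ _ (d0 j) (N k.+1 j)
    (omega k.+1 j) (d k.+1 j) (z k.+1 j) (fun w => submxrow (v k.+1 w) j)) => //.
  - by move=> a y e; exact: hsubgrad.
  - by move=> y; exact: hg_meas.
  - by move=> w; exact: vY.
  - by move=> w; exact: hfeas.
  - by move=> i iN; have [] := history_step (x 0%N) (u 0%N) omega d (ltn0Sn k) iN.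
  - by move=> i iN; have [] := history_step (x 0%N) (u 0%N) omega d (ltn0Sn k) iN.
have vmeas k : @random_vector R _ (g_sigma_algebraType (H k.+1)) _ (v k.+1).
  by have [mx mu_] := meas k; have [] := popov_meas k _ mx mu_.
have toO G m (X : Omega -> 'rV[R]_m) : G `<=` measurable ->
    @random_vector R _ (g_sigma_algebraType G) _ X -> random_vector X.
  move=> Gm mX i _ B mB; apply: (generated_sigma_algebra_measurable Gm).
  exact: (mX i measurableT B mB).
have mx k : random_vector (x k) by have [h _] := meas k; exact: toO h.
have mu_ k : random_vector (u k) by have [_ h] := meas k; exact: toO h.
have mv k : random_vector (v k.+1) by exact: toO (vmeas k).
(* eta is small enough for the gain gamma * Phi of the first feasibility step
   to pay, in expectation, for twice the term eta * D of the descent, and for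
   eta * D to be absorbed by the left-hand side when proving integrability *)
have [b0 b2] := andP hbeta.
pose gamma := beta * (2 - beta) / M_g ^+ 2.
have gamma0 : 0 < gamma.
  by rewrite divr_gt0 ?exprn_gt0// mulr_gt0//; lra.
pose eta := Num.min (1 / 2) (gamma / (2 * c)).
have c2 : 0 < 2 * c by lra.
have eta0 : 0 < eta by rewrite lt_min divr_gt0// divr_gt0.
have eta_half : eta <= 1 / 2 by rewrite ge_min lexx.
have eta_gamma : 2 * eta * c <= gamma.
  by rewrite mulrAC mulrC -ler_pdivlMr// ge_min lexx orbT.
pose K := (8 + eta^-1) * eucl (F xstar) ^+ 2.
have K0 : 0 <= K.
  by rewrite mulr_ge0 ?sqr_ge0// addr_ge0// invr_ge0 ltW.
(* tau > 2 turns the first of the three step size bounds into mu / 8 *)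
have aL k : alpha k * L ^+ 2 <= mu / 8.
  have L2 : 0 < L ^+ 2 by rewrite exprn_gt0.
  have : alpha k <= mu / (4 * tau * L ^+ 2).
    by apply: le_trans (halpha_le k) _; rewrite ge_min lexx.
  have t4 : 0 < 4 * tau by lra.
  rewrite ler_pdivlMr ?(mulr_gt0 t4 L2)// => h.
  have : alpha k * L ^+ 2 * 8 <= alpha k * (4 * tau * L ^+ 2).
    have -> : alpha k * (4 * tau * L ^+ 2) = alpha k * L ^+ 2 * (4 * tau) by ring.
    by apply: ler_wpM2l; [rewrite mulr_ge0 ?sqr_ge0// ltW|lra].
  lra.
pose a k w := eucl (x k w - xstar) ^+ 2.
pose b k w := eucl (u k w - xstar) ^+ 2.
pose t k w := eucl (x k w - u k.+1 w) ^+ 2.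
pose vv k w := eucl (v k.+1 w - xstar) ^+ 2.
pose D k w := \sum_(j < J) dist (submxrow (v k.+1 w) j) (S j) ^+ 2.
pose Phi k w := \sum_(j < J)
  ((g j (omega k.+1 j 1%N w))^\+ (submxrow (v k.+1 w) j)) ^+ 2.
have descent k w : vv k w + t k w + 3 / 2 * (alpha k * mu * b k.+1 w) <=
    a k w + alpha k * mu * b k w + K * alpha k ^+ 2 + eta * D k w.
  apply: (popov_step_descent hY_closed Y0 hY_convex hF_lip S0 _ hF_mono
    (halpha_gt0 k) hmu hL (aL k) eta0 hxstar (uY k w) (step k w)).
  by move=> j y [].
have feasible k w : a k.+1 w + gamma * Phi k w <= vv k w.
  rewrite /a /vv !eucl_sqr_blocks /Phi mulr_sumr -big_split.
  apply: ler_sum => j _; rewrite !submxrowB.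
  apply: (feasibility_steps_decrease _ _ _ _ hM_g _ hbeta _ _ _ _
    (hfeas k.+1 j w isT)) => //.
  - by move=> a' y e; exact: hsubgrad.
  - exact: hN.
  - exact: vY.
  - by move=> a'; have [Xj _] := xsS j; exact: Xj.
have D_le k w : D k w <= vv k w.
  rewrite /vv eucl_sqr_blocks; apply: ler_sum => j _.
  rewrite lerXn2r ?nnegrE ?dist_ge0 ?eucl_ge0// submxrowB.
  exact/dist_le/xsS.
have a_le k w : a k w <= 2 * b k.+1 w + 2 * t k w by exact: eucl_sqr_triangleB.
have mB k : random_vector (fun w => x k w - xstar).
  by apply: random_vectorB => //; exact: random_vector_cst.
have mvB k : random_vector (fun w => v k.+1 w - xstar).
  by apply: random_vectorB => //; exact: random_vector_cst.
have ma k : measurable_fun [set: Omega] (a k) by exact: measurable_eucl_sqr.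
have mb k : measurable_fun [set: Omega] (b k).
  by apply/measurable_eucl_sqr/random_vectorB => //; exact: random_vector_cst.
have mt k : measurable_fun [set: Omega] (t k).
  exact/measurable_eucl_sqr/random_vectorB.
have mvv k : measurable_fun [set: Omega] (vv k) by exact: measurable_eucl_sqr.
have mvj k j : random_vector (fun w => submxrow (v k.+1 w) j).
  exact: (random_vector_blocks _).1 (mv k) j.
have mDj k j : measurable_fun [set: Omega]
    (fun w => dist (submxrow (v k.+1 w) j) (S j) ^+ 2).
  apply: measurable_funX.
  exact: (measurable_lipschitz_comp (mvj k j) (dist_lipschitz (S0 j))).
have hom k j : measurable_fun [set: Omega] (omega k.+1 j 1%N).
  by apply: homega => //; rewrite hN.
have mPhij k j : measurable_fun [set: Omega]
    (fun w => ((g j (omega k.+1 j 1%N w))^\+ (submxrow (v k.+1 w) j)) ^+ 2).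
  apply: measurable_funX; apply: (measurable_violation (M := M_g) (Y := Y j)) => //.
  - by move=> a' y e; exact: hsubgrad.
  - by move=> y; exact: hg_meas.
  - by move=> w; exact: vY.
have mD k : measurable_fun [set: Omega] (D k) by exact: measurable_sum.
have mPhi k : measurable_fun [set: Omega] (Phi k) by exact: measurable_sum.
have D_Phi k : (\int[P]_w (D k w)%:E <= c%:E * \int[P]_w (Phi k w)%:E)%E.
  rewrite /D /Phi.
  under eq_integral do rewrite -sumEFin.
  under [X in (_ <= _ * X)%E]eq_integral do rewrite -sumEFin.
  rewrite ge0_integral_sum//; last 2 first.
  - by move=> j; exact/measurable_EFinP.
  - by move=> j w _; rewrite lee_fin sqr_ge0.
  rewrite ge0_integral_sum//; last 2 first.
  - by move=> j; exact/measurable_EFinP.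
  - by move=> j w _; rewrite lee_fin sqr_ge0.
  rewrite ge0_sume_distrr; last first.
    by move=> j _; apply: integral_ge0 => w _; rewrite lee_fin sqr_ge0.
  apply: lee_sum => j _.
  apply: (@cond_expectation_ge_random_point R dO Omega P (H k.+1) c (Hm k.+1) hc (n j)
    (Y j) (fun w => submxrow (v k.+1 w) j) (fun w => (g j (omega k.+1 j 1%N w))^\+)
    (fun y => dist y (S j)) M_g) => //.
  - by move=> w; exact: vY.
  - exact: (random_vector_blocks _).1 (vmeas k) j.
  - move=> y Yy; apply: (@measurable_maxr _ _ _ _
      (fun w => g j (omega k.+1 j 1%N w) y) (fun=> 0)) => //.
    exact: measurableT_comp (hg_meas j y Yy) (hom k j).
  - move=> w y y' Yy Yy'; apply: (pos_part_lipschitz (Y := Y j)) => //.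
    by move=> p e; exact: hsubgrad.
  - exact: dist_lipschitz.
  - by move=> y Yy; apply: hreg => //; rewrite hN.
have alpha_dvg : ~ cvgn (series alpha).
  move=> /(summable_is_cvg_series (fun k => ltW (halpha_gt0 k))).
  by rewrite halpha_sum ltxx.
have alpha2_cvg : cvgn (series (fun k => alpha k ^+ 2)).
  by apply/summable_is_cvg_series => // k; exact: sqr_ge0.
have D0 k w : 0 <= D k w by apply: sumr_ge0 => j _; exact: sqr_ge0.
have Phi0 k w : 0 <= Phi k w by apply: sumr_ge0 => j _; exact: sqr_ge0.
have a0 k w : 0 <= a k w by exact: sqr_ge0.
have b0' k w : 0 <= b k w by exact: sqr_ge0.
have t0 k w : 0 <= t k w by exact: sqr_ge0.
have vv0 k w : 0 <= vv k w by exact: sqr_ge0.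
have ia0 := integrable_eucl_sqr_sub xstar hx0 hx0L2.
have ib0 := integrable_eucl_sqr_sub xstar hu0 hu0L2.
have [iab Ea_0 Evv_0] := expected_square_cvg0 ma mb mt mD mPhi mvv a0 b0' t0 D0
  Phi0 vv0 hmu gamma0 eta0 K0 eta_half eta_gamma halpha_gt0 halpha_noninc
  alpha_dvg alpha2_cvg ia0 ib0 descent feasible D_le a_le D_Phi.
have [ae_a ae_vv] := ae_square_cvg0 ma mb mt mD mPhi mvv a0 b0' t0 D0
  Phi0 vv0 hmu gamma0 eta0 K0 eta_half eta_gamma halpha_gt0 halpha_noninc
  alpha_dvg alpha2_cvg ia0 ib0 descent feasible D_le a_le D_Phi.
have PS0 : product_set S !=set0 by exists xstar.
have dist_x k w : dist (x k w) (product_set S) <= eucl (x k w - xstar).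
  exact: dist_le.
have ae_x : {ae P, forall w, eucl (x k w - xstar) @[k --> \oo] --> 0}.
  by apply: filterS ae_a => w; apply: cvg0_of_sqr => k; exact: eucl_ge0.
have euclL (y y' : 'rV[R]_(\sum_(j < J) n j)) : `|eucl y - eucl y'| <= eucl (y - y').
  by have := eucl_sub_lipschitz 0 y y'; rewrite !sub0r !euclN.
split.
- by move=> k w; split; [exact: xY|case: k => // k _; exact: vY].
- split => //; apply: filterS ae_vv => w h.
  rewrite -(cvg_shiftS (fun k => eucl (v k w - xstar))).
  by apply: cvg0_of_sqr h => k; exact: eucl_ge0.
- split.
    apply: (expectation_cvg0 (s := a)) => //.
    + by move=> k; exact: (measurable_lipschitz_comp (mB k) euclL).
    + by move=> k w; exact: eucl_ge0.
    + by move=> k; have [] := iab k.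
  rewrite -(cvg_shiftS (fun k => 'E_P[(fun w => eucl (v k w - xstar))%R]%E)).
  apply: (expectation_cvg0 (f := fun k w => eucl (v k.+1 w - xstar)) (s := vv)) => //.
  + by move=> k; exact: (measurable_lipschitz_comp (mvB k) euclL).
  + by move=> k w; exact: eucl_ge0.
  + by move=> k; have [] := iab k.
- apply: filterS ae_x => w h; apply: squeeze_cvgr h; last exact: cvg_cst.
  by apply: nearW => k; rewrite dist_ge0 ?dist_x.
- apply: (expectation_cvg0 (s := a)) => //.
  + by move=> k; exact: (measurable_lipschitz_comp (mx k) (dist_lipschitz PS0)).
  + by move=> k w; exact: dist_ge0.
  + by move=> k w; rewrite lerXn2r ?nnegrE ?dist_ge0 ?eucl_ge0.
  + by move=> k; have [] := iab k.
Qed.
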